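(* The mirror of every complex reflection in $\Gamma_2$ is in the $\Gamma_2$-orbit of the mirror polar to exactly one of the vectors $w_1=(0,1,0)$, $w_2=(1,-1,0)$, $w_3=(1,0,1)$. The subgroup of $\Gamma_2$ fixing pointwise the mirror polar to each of $w_1,w_2,w_3$ is cyclic of order $2$.
   Context: On $\mathbb{C}^3$ let $\langle v,w\rangle=w^*Jv$ with $J=\begin{pmatrix}0&0&1\\0&1&0\\1&0&0\end{pmatrix}$, $U(J)=\{A\in GL_3(\mathbb{C}):A^*JA=J\}$, and let $\Gamma_d=PU(J,\mathcal{O}_d)$ be the image in $PU(J)$ of $U(J)\cap GL_3(\mathcal{O}_d)$, with $\mathcal{O}_d$ the ring of integers of $\mathbb{Q}(i\sqrt d)$ (so $\mathcal{O}_2=\mathbb{Z}[i\sqrt2]$). It acts on the complex hyperbolic plane $\mathbf{H}^2_{\mathbb{C}}=\{\mathbb{C}v:\langle v,v\rangle<0\}$. For $w$ with $\langle w,w\rangle>0$, the mirror polar to $w$ is $\{\mathbb{C}v\in\mathbf{H}^2_{\mathbb{C}}:\langle v,w\rangle=0\}$; a complex reflection is a nontrivial finite-order element fixing pointwise such a mirror. *)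

(* Defs.v *)
From HB Require Import structures.
From mathcomp Require Import all_boot all_order all_algebra.
From mathcomp Require Import generic_quotient.
From mathcomp Require Import boolp classical_sets functions cardinality reals.
From mathcomp Require Import complex.

Set Implicit Arguments.
Unset Strict Implicit.
Unset Printing Implicit Defensive.

Import Order.TTheory GRing.Theory Num.Theory.

Local Open Scope classical_set_scope.
Local Open Scope quotient_scope.
Local Open Scope sesquilinear_scope.
Local Open Scope ring_scope.

Section HermitianForm.
Variable C : numClosedFieldType.

Definition cvec3 (a b c : C) : 'cV[C]_3 := \col_i [:: a; b; c]`_i.

(* The antidiagonal matrix: its (i, j) entry is 1 exactly when i + j = 2. *)
Definition J : 'M[C]_3 := \matrix_(i, j) (i + j == 2)%N%:R.

Lemma J_sqr : J *m J = 1%:M.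
Proof.
apply/matrixP => i j; rewrite !mxE !big_ord_recl big_ord0 !mxE.
case: i => [[|[|[|//]]] ?]; case: j => [[|[|[|//]]] ?];
  by rewrite /= ?mulr0 ?mul0r ?mulr1 ?add0r ?addr0.
Qed.

Definition hform (v w : 'cV[C]_3) : C := (w ^t* *m J *m v) 0 0.

Definition unitaryJ : {pred 'M[C]_3} :=
  [pred A | (A \in unitmx) && (A ^t* *m J *m A == J)].

Lemma unitaryJ1 : 1%:M \in unitaryJ.
Proof. by rewrite inE unitmx1 trmx1 map_mx1 mul1mx mulmx1 eqxx. Qed.

Lemma unitaryJM A B :
  A \in unitaryJ -> B \in unitaryJ -> A *m B \in unitaryJ.
Proof.
rewrite !inE => /andP[uA /eqP hA] /andP[uB /eqP hB].
rewrite unitmx_mul uA uB /= trmx_mul map_mxM.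
by rewrite !mulmxA -(mulmxA _ _ J) -(mulmxA _ _ A) hA hB.
Qed.

Lemma unitaryJV A : A \in unitaryJ -> invmx A \in unitaryJ.
Proof.
rewrite !inE => /andP[uA /eqP hA]; rewrite unitmx_inv uA /=; apply/eqP.
rewrite -{1}hA !mulmxA -map_mxM -trmx_mul mulmxV // trmx1 map_mx1 mul1mx.
by rewrite -mulmxA mulmxV // mulmx1.
Qed.

End HermitianForm.

Record UJ (C : numClosedFieldType) :=
  MkUJ { UJmx :> 'M[C]_3; UJmxP : UJmx \in @unitaryJ C }.

HB.instance Definition _ (C : numClosedFieldType) := [isSub for @UJmx C].
HB.instance Definition _ (C : numClosedFieldType) :=
  [Choice of UJ C by <:].

Section UJGroup.
Variable C : numClosedFieldType.
Implicit Types A B : UJ C.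

Definition UJ_one : UJ C := MkUJ (unitaryJ1 C).
Definition UJ_mul A B : UJ C := MkUJ (unitaryJM (UJmxP A) (UJmxP B)).
Definition UJ_inv A : UJ C := MkUJ (unitaryJV (UJmxP A)).

Lemma UJ_unit A : (A : 'M[C]_3) \in unitmx.
Proof. by have /andP[] := UJmxP A. Qed.

Lemma UJ_mulA : associative UJ_mul.
Proof. by move=> x y z; apply: val_inj; exact: mulmxA. Qed.

Lemma UJ_mul1 : left_id UJ_one UJ_mul.
Proof. by move=> x; apply: val_inj; exact: mul1mx. Qed.

Lemma UJ_1mul : right_id UJ_one UJ_mul.
Proof. by move=> x; apply: val_inj; exact: mulmx1. Qed.

Lemma UJ_mulV : left_inverse UJ_one UJ_inv UJ_mul.
Proof. by move=> x; apply: val_inj; exact: mulVmx (UJ_unit x). Qed.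

Lemma UJ_Vmul : right_inverse UJ_one UJ_inv UJ_mul.
Proof. by move=> x; apply: val_inj; exact: mulmxV (UJ_unit x). Qed.

HB.instance Definition _ :=
  isGroup.Build (UJ C) UJ_mulA UJ_mul1 UJ_1mul UJ_mulV UJ_Vmul.

(* A scalar c relating two elements of U(J) automatically has modulus 1. *)
Definition proj_eq A B : bool :=
  `[< exists c : C, (A : 'M[C]_3) = c *: (B : 'M[C]_3) >].

Lemma proj_eq_refl : reflexive proj_eq.
Proof. by move=> A; apply/asboolP; exists 1; rewrite scale1r. Qed.

Lemma UJ_neq0 A : (A : 'M[C]_3) != 0.
Proof.
by apply: contraTneq (UJ_unit A) => ->; rewrite unitmxE det0 unitr0.
Qed.

Lemma proj_eq_sym : symmetric proj_eq.
Proof.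
have sym A B : proj_eq A B -> proj_eq B A.
  move=> /asboolP[c cAB]; apply/asboolP; exists c^-1.
  rewrite cAB scalerA mulVf ?scale1r //; apply/eqP => c0.
  by have := UJ_neq0 A; rewrite cAB c0 scale0r eqxx.
by move=> A B; apply/idP/idP; exact: sym.
Qed.

Lemma proj_eq_trans : transitive proj_eq.
Proof.
move=> B A D /asboolP[a ea] /asboolP[b eb].
by apply/asboolP; exists (a * b); rewrite ea eb scalerA.
Qed.

Canonical proj_eq_equiv := EquivRel proj_eq
  proj_eq_refl proj_eq_sym proj_eq_trans.

End UJGroup.

Definition PU (C : numClosedFieldType) : Type := {eq_quot (@proj_eq C)}.

HB.instance Definition _ (C : numClosedFieldType) := Choice.on (PU C).
HB.instance Definition _ (C : numClosedFieldType) := EqQuotient.on (PU C).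

Section PUGroup.
Variable C : numClosedFieldType.
Implicit Types A B : UJ C.

Lemma PU_eqP A B :
  reflect (exists c : C, (A : 'M[C]_3) = c *: (B : 'M[C]_3))
          (\pi_(PU C) A == \pi_(PU C) B).
Proof. by rewrite eqmodE; apply: asboolP. Qed.

Definition PU_one : PU C := \pi_(PU C) (1%g : UJ C).
Definition PU_mul (g h : PU C) : PU C := \pi_(PU C) (repr g * repr h)%g.
Definition PU_inv (g : PU C) : PU C := \pi_(PU C) ((repr g)^-1)%g.

Lemma PU_mulE A B : PU_mul (\pi_(PU C) A) (\pi_(PU C) B) = \pi_(PU C) (A * B)%g.
Proof.
apply/eqP/PU_eqP.
have /eqP/PU_eqP[a ea] := reprK (\pi_(PU C) A).
have /eqP/PU_eqP[b eb] := reprK (\pi_(PU C) B).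
exists (a * b).
by rewrite /= ea eb -scalemxAl -scalemxAr scalerA.
Qed.

Lemma PU_mulA : associative PU_mul.
Proof.
elim/quotW => x; elim/quotW => y; elim/quotW => z.
by rewrite (PU_mulE y z) (PU_mulE x y) (PU_mulE x) (PU_mulE _ z) mulgA.
Qed.

Lemma PU_mul1 : left_id PU_one PU_mul.
Proof. by elim/quotW => x; rewrite PU_mulE mul1g. Qed.

Lemma PU_1mul : right_id PU_one PU_mul.
Proof. by elim/quotW => x; rewrite PU_mulE mulg1. Qed.

Lemma PU_mulV : left_inverse PU_one PU_inv PU_mul.
Proof. by move=> x; rewrite -[X in PU_mul _ X]reprK PU_mulE mulVg. Qed.

Lemma PU_Vmul : right_inverse PU_one PU_inv PU_mul.
Proof. by move=> x; rewrite -[X in PU_mul X _]reprK PU_mulE mulgV. Qed.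

HB.instance Definition _ :=
  isGroup.Build (PU C) PU_mulA PU_mul1 PU_1mul PU_mulV PU_Vmul.

End PUGroup.

Section Lattice.
Variable C : numClosedFieldType.

Definition imag_quad_field (d : nat) : set C :=
  [set z | exists a b : rat, z = ratr a + ratr b * ('i * sqrtC d%:R)].

Definition ring_of_integers (d : nat) : set C :=
  [set z | imag_quad_field d z /\ integralOver (intmul 1 : int -> C) z].

Definition GL3_over (S : set C) : set 'M[C]_3 :=
  [set A | A \in unitmx /\ forall i j, S (A i j) /\ S (invmx A i j)].

Definition Gamma (d : nat) : set (PU C) :=
  [set \pi_(PU C) A | A in [set A : UJ C | GL3_over (ring_of_integers d) A]].

End Lattice.

Section HyperbolicPlane.
Variable C : numClosedFieldType.

(* Points of the complex hyperbolic plane are lines C v, seen as sets of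
   column vectors. *)
Definition line (v : 'cV[C]_3) : set 'cV[C]_3 := [set c *: v | c in setT].

Definition hyperbolic_plane : set (set 'cV[C]_3) :=
  [set line v | v in [set v | hform v v < 0]].

Definition act (g : PU C) (p : set 'cV[C]_3) : set 'cV[C]_3 :=
  [set (repr g : 'M[C]_3) *m x | x in p].

Lemma act_line (A : UJ C) (v : 'cV[C]_3) :
  act (\pi_(PU C) A) (line v) = line ((A : 'M[C]_3) *m v).
Proof.
have /eqP/PU_eqP[a ea] := reprK (\pi_(PU C) A).
have a0 : a != 0.
  apply/eqP => a0; have := UJ_neq0 (repr (\pi_(PU C) A)).
  by rewrite ea a0 scale0r eqxx.
apply/seteqP; split => y /=.
- move=> [_ [c _ <-] <-]; exists (a * c) => //.
  by rewrite ea -scalemxAl -scalemxAr scalerA.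
- move=> [c _ <-]; exists (a^-1 * c *: v); first by exists (a^-1 * c).
  by rewrite ea -scalemxAl -scalemxAr scalerA mulrA divff // mul1r.
Qed.

Definition mirror (w : 'cV[C]_3) : set (set 'cV[C]_3) :=
  hyperbolic_plane `&` [set line v | v in [set v | hform v w = 0]].

Definition fixes_pointwise (g : PU C) (M : set (set 'cV[C]_3)) : Prop :=
  forall p, M p -> act g p = p.

(* g is a complex reflection whose mirror is the mirror polar to w. *)
Definition complex_reflection_with_mirror (g : PU C) (w : 'cV[C]_3) : Prop :=
  [/\ g <> 1%g, exists2 n : nat, (0 < n)%N & (g ^+ n)%g = 1%g,
      0 < hform w w & fixes_pointwise g (mirror w)].

Definition pointwise_stabilizer (G : set (PU C)) (M : set (set 'cV[C]_3)) :
  set (PU C) := [set g | G g /\ fixes_pointwise g M].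

Definition wvec (i : 'I_3) : 'cV[C]_3 :=
  tnth [tuple cvec3 0 1 0; cvec3 1 (-1) 0; cvec3 1 0 1] i.

End HyperbolicPlane.

Definition cyclic_of_order (n : nat) (G : groupType) (H : set G) : Prop :=
  (exists g : G, H = [set h | exists k : nat, h = g ^+ k \/ h = g ^- k]%g) /\
  (H #= `I_n)%card.

(* Main.v *)
(* Put theta = i sqrt 2. An element of Gamma_2 fixing the mirror polar to w acts as a scalar on the
   orthogonal of w; that scalar is an algebraic integer of Q(theta) of modulus 1, hence +-1, and the
   element is either trivial or the reflection y |-> y - 2 <y,w>/<w,w> w. Integrality of the latter
   forces w to be proportional to a primitive vector of Z[theta]^3 of norm 1 or 2. Gauss reduction
   of the binary form on the polar lattice of w yields an isotropic primitive vector, which the group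
   moves to (1,0,0); then w becomes (x,y,0) with |y|^2 in {1,2}, and Heisenberg translations
   leave finitely many vectors, each carried to a w_i by an explicit matrix. The three orbits are
   separated by the norm and, for w_1 and w_2, by the fact that w_1 is characteristic modulo theta:
   <z,z> = <z,w_1> mod theta for every integral z. *)
Require Import Defs.
From HB Require Import structures.
From mathcomp Require Import all_boot all_order all_algebra.
From mathcomp Require Import generic_quotient.
From mathcomp Require Import ring lra zify.
From mathcomp Require Import boolp classical_sets functions cardinality reals.
From mathcomp Require Import complex.
Set Implicit Arguments.
Unset Strict Implicit.
Unset Printing Implicit Defensive.
Import Order.TTheory GRing.Theory Num.Theory.
Local Open Scope classical_set_scope.
Local Open Scope sesquilinear_scope.
Local Open Scope quotient_scope.
Local Open Scope ring_scope.

(** * Algebraic integers of Q(theta) and the ring Z[theta] *)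

(** By Gauss's lemma, [X - x] is a rational multiple of an integral factor [p1] of the monic
    polynomial. The leading coefficient of [p1] divides 1, so [p1] is [X - x] up to sign and its
    constant term is [x] up to sign. *)
Lemma rat_integral_int (C : numClosedFieldType) (x : rat) :
  integralOver (intmul 1 : int -> C) (ratr x) -> exists n : int, x = n%:~R.
Proof.
case=> p pm; have -> : map_poly (intmul 1 : int -> C) p
    = map_poly ratr (map_poly (intmul 1 : int -> rat) p).
  by rewrite -map_poly_comp; apply: eq_map_poly => z /=; rewrite ratr_int.
rewrite fmorph_root -dvdp_XsubCl => /dvdpP_rat_int[p1 [a a0 e1] [r e2]].
have lr : lead_coef p1 * lead_coef r = 1 by rewrite -lead_coefM -e2 (eqP pm).
have al : a * (lead_coef p1)%:~R = 1.
  have := congr1 lead_coef e1; rewrite lead_coefXsubC lead_coefZ.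
  by rewrite lead_coef_map_inj //; apply: intr_inj.
have ax := congr1 (fun q : {poly rat} => q`_0) e1.
rewrite /= coefB coefX coefC coefZ coef_map /= sub0r in ax.
have : lead_coef p1 = 1 \/ lead_coef p1 = -1.
  have := congr1 absz lr; rewrite abszM => /eqP; rewrite muln_eq1 => /andP[/eqP] + _.
  by lia.
case=> h; rewrite h in al; rewrite -[x]opprK ax.
  by exists (- p1`_0); rewrite mulr1 in al; rewrite al mul1r rmorphN.
exists (p1`_0); have -> : a = -1 by lra.
by rewrite mulN1r opprK.
Qed.

Lemma monicX2DC (c : int) : 'X^2 + c%:P \is monic.
Proof.
rewrite monicE lead_coefDl ?lead_coefXn // size_polyXn size_polyC.
by case: (c != 0).
Qed.

Section Ring.
Variable C : numClosedFieldType.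

Lemma conjCD (x y : C) : (x + y)^* = x^* + y^*.
Proof. exact: rmorphD. Qed.
Lemma conjCM (x y : C) : (x * y)^* = x^* * y^*.
Proof. exact: rmorphM. Qed.
Lemma conjCN (x : C) : (- x)^* = - x^*.
Proof. exact: rmorphN. Qed.

Definition theta : C := 'i * sqrtC 2%:R.

Lemma theta2 : theta * theta = -2%:R.
Proof. by rewrite /theta mulrACA -!expr2 sqrCi sqrtCK mulN1r. Qed.

Lemma conj_theta : theta^* = - theta.
Proof.
rewrite /theta rmorphM /= conjCi mulNr; congr (- (_ * _)).
by apply/CrealP/ger0_real; rewrite sqrtC_ge0 ler0n.
Qed.

Lemma theta_neq0 : theta != 0.
Proof.
by apply/eqP => h; have := theta2; rewrite h mul0r => /eqP; rewrite eq_sym oppr_eq0 pnatr_eq0.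
Qed.

Definition Zth (a b : int) : C := a%:~R + b%:~R * theta.

Lemma conj_Zth a b : (Zth a b)^* = Zth a (- b).
Proof.
by rewrite /Zth rmorphD rmorphM /= conj_theta !rmorph_int rmorphN mulrN mulNr.
Qed.

Lemma ZthM a b c d : Zth a b * Zth c d = Zth (a * c - 2 * (b * d)) (a * d + b * c).
Proof.
rewrite /Zth !(rmorphB, rmorphD, rmorphM) /=.
by transitivity (a%:~R * c%:~R + (b%:~R * d%:~R) * (theta * theta) +
  (a%:~R * d%:~R + b%:~R * c%:~R) * theta); [ring | rewrite theta2; ring].
Qed.

Lemma Zth_norm a b : Zth a b * (Zth a b)^* = (a * a + 2 * (b * b))%:~R.
Proof.
rewrite conj_Zth ZthM /Zth (_ : _ + b * a = 0); last by ring.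
by rewrite mul0r addr0; congr (_%:~R); ring.
Qed.

Lemma ratr_conj (a : rat) : (ratr a : C)^* = ratr a.
Proof. exact: fmorph_rat. Qed.

Lemma Zth_eq0 a b : Zth a b = 0 -> a = 0 /\ b = 0.
Proof.
move=> h; have := Zth_norm a b; rewrite h mul0r => /esym/eqP.
by rewrite intr_eq0 => /eqP; nia.
Qed.

Lemma Zth_inj a b c d : Zth a b = Zth c d -> a = c /\ b = d.
Proof.
move=> h; have [] : a - c = 0 /\ b - d = 0; last by lia.
by apply: Zth_eq0; rewrite /Zth !rmorphB /= -[RHS](subrr (Zth a b)) {2}h /Zth; ring.
Qed.

(** A boolean predicate with a subring structure, so that the [rpred] lemmas apply;
    [ring_of_integersE] identifies it with the ring of integers. *)
Definition Oth : {pred C} := [pred z | `[< exists a b, z = Zth a b >]].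

Lemma OthP z : reflect (exists a b, z = Zth a b) (z \in Oth).
Proof. exact: asboolP. Qed.

Lemma Oth_subring : subring_closed Oth.
Proof.
split.
- by apply/OthP; exists 1, 0; rewrite /Zth mul0r addr0.
- move=> _ _ /OthP[a [b ->]] /OthP[c [d ->]]; apply/OthP; exists (a - c), (b - d).
  by rewrite /Zth !rmorphB /=; ring.
- move=> _ _ /OthP[a [b ->]] /OthP[c [d ->]]; apply/OthP.
  by eexists; eexists; exact: ZthM.
Qed.
HB.instance Definition _ := GRing.isSubringClosed.Build C Oth Oth_subring.

Lemma Oth_theta : theta \in Oth.
Proof. by apply/OthP; exists 0, 1; rewrite /Zth add0r mul1r. Qed.

Lemma Oth_conj z : z \in Oth -> z^* \in Oth.
Proof. by move=> /OthP[a [b ->]]; apply/OthP; exists a, (-b); rewrite conj_Zth. Qed.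

Lemma Oth_int (n : int) : n%:~R \in Oth.
Proof. by rewrite rpred_int. Qed.

Lemma Oth_normN z : z \in Oth -> exists n : nat, z * z^* = n%:R.
Proof.
move=> /OthP[a [b ->]]; rewrite Zth_norm.
by exists `|(a * a + 2 * (b * b))%R|%N; rewrite natr_absz ger0_norm //; nia.
Qed.

Lemma integral_conj (z : C) : integralOver (intmul 1 : int -> C) z ->
  integralOver (intmul 1 : int -> C) z^*.
Proof.
case=> p pm pz; exists p => //.
have -> : map_poly (intmul 1 : int -> C) p
    = map_poly Num.conj (map_poly (intmul 1 : int -> C) p).
  by rewrite -map_poly_comp; apply: eq_map_poly => x /=; rewrite rmorph_int.
by rewrite fmorph_root.
Qed.

Lemma Oth_integral z : z \in Oth -> integralOver (intmul 1 : int -> C) z.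
Proof.
move=> /OthP[a [b ->]]; apply: integral_add; first exact: integral_id.
apply: integral_mul; first exact: integral_id.
exists ('X^2 + 2%:P); first exact: monicX2DC.
rewrite rmorphD /= map_polyXn map_polyC /= /root hornerD hornerXn hornerC.
by rewrite expr2 theta2; apply/eqP; ring.
Qed.

(** For z = a + b theta integral, the trace m = 2a and the norm n = a^2 + 2b^2 are rational
    algebraic integers, hence integers; a parity argument then removes the denominators. *)
Lemma ring_of_integersE (z : C) : ring_of_integers 2 z <-> z \in Oth.
Proof.
split=> [[[a [b zE]] zint]|zO]; last first.
  split; last exact: Oth_integral.
  by case/OthP: zO => a [b ->]; exists a%:~R, b%:~R; rewrite !ratr_int.
rewrite -/theta in zE.
have zc : z^* = ratr a - ratr b * theta.
  by rewrite zE conjCD [(ratr b * _)^*]conjCM !ratr_conj conj_theta mulrN.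
have [m am] : exists m : int, a + a = m%:~R.
  apply: (@rat_integral_int C); rewrite rmorphD /=.
  have -> : ratr a + ratr a = z + z^* by rewrite zc zE; ring.
  by apply: integral_add => //; apply: integral_conj.
have [n bn] : exists n : int, a * a + (b * b + b * b) = n%:~R.
  apply: (@rat_integral_int C); rewrite !rmorphD !rmorphM /=.
  have -> : ratr a * ratr a + (ratr b * ratr b + ratr b * ratr b) = z * z^*.
    rewrite zc zE; transitivity (ratr a * ratr a - ratr b * ratr b * (theta * theta)).
      by rewrite theta2; ring.
    by ring.
  by apply: integral_mul => //; apply: integral_conj.
(* The square of 4b is the integer 8n - 2m^2, so 4b is again a rational algebraic integer. *)
have [k bk] : exists k : int, 4 * b = k%:~R.
  apply: (@rat_integral_int C).
  have sq : 4 * b * (4 * b) = (8 * n - 2 * (m * m))%:~R.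
    by rewrite !(rmorphB, rmorphM) /= -am -bn; ring.
  exists ('X^2 - (8 * n - 2 * (m * m))%:P).
    by rewrite -polyCN; exact: monicX2DC.
  rewrite rmorphB /= map_polyXn map_polyC /= /root hornerD hornerN hornerXn hornerC.
  by rewrite expr2 -rmorphM sq /= ratr_int subrr.
have mk : 2 * (m * m) + k * k = 8 * n.
  by apply: (@intr_inj rat); rewrite !(rmorphD, rmorphM) /= -am -bn -bk; ring.
(* Successive reductions of 2m^2 + k^2 = 8n modulo powers of 2 show that k, then m, then k/2 is
   even. *)
have [k' kE] : exists k', k = 2 * k'.
  exists (k %/ 2)%Z; nia.
have [m' mE] : exists m', m = 2 * m' by exists (m %/ 2)%Z; nia.
have [l lE] : exists l, k' = 2 * l by exists (k' %/ 2)%Z; nia.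
apply/OthP; exists m', l; rewrite zE /Zth -!(ratr_int C).
have -> : a = m'%:~R.
  by have : a + a = m'%:~R + m'%:~R; [rewrite am mE; ring | lra].
have -> // : b = l%:~R.
by have : 4 * b = 4 * l%:~R; [rewrite bk kE lE !rmorphM /=; ring | lra].
Qed.
End Ring.

Ltac solve_Oth := repeat match goal with
  | |- is_true (_ \in _) => first [assumption | apply: Oth_theta]
  | |- is_true (_ - _ \in _) => apply: rpredB
  | |- is_true (_ + _ \in _) => apply: rpredD
  | |- is_true (- _ \in _) => rewrite rpredN
  | |- is_true (_ * _ \in _) => apply: rpredM
  | |- is_true (_ ^* \in _) => apply: Oth_conj
  | |- is_true (0 \in _) => apply: rpred0
  | |- is_true (1 \in _) => apply: rpred1
  | |- is_true (_%:R \in _) => apply: rpred_nat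
  | |- is_true (_%:~R \in _) => apply: Oth_int
  end.

(** * Euclidean division and Bezout relations in Z[theta] *)

Section Bezout.
Variable C : numClosedFieldType.
Local Notation Oth := (@Oth C).

Lemma int_round (a N : int) : N != 0 -> exists q : int, 4 * ((a - q * N) * (a - q * N)) <= N * N.
Proof.
wlog N0 : N / 0 < N => [hw N0|_].
  have [/hw|h] := ltrP 0 N; first by apply; rewrite ?N0.
  have [||q hq] := hw (- N); try lia.
  by exists (- q); move: hq; rewrite !mulrNN mulrN mulNr.
(* The floor of a/N + 1/2, which is a nearest integer to a/N. *)
exists ((2 * a + N) %/ (2 * N))%Z.
have := divz_eq (2 * a + N) (2 * N).
have := ltz_pmod (2 * a + N) (_ : 0 < 2 * N); have := modz_ge0 (2 * a + N) (_ : 2 * N != 0).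
set q := (_ %/ _)%Z; set r := (_ %% _)%Z => h1 h2 e.
have {h1} h1 : 0 <= r by apply: h1; lia.
have {h2} h2 : r < 2 * N by apply: h2; lia.
have : 2 * (a - q * N) = r - N by lia.
nia.
Qed.

(** Rounding both coordinates of z/N leaves errors of at most 1/2, so the remainder has norm at most
    (1/4 + 2/4) N^2. That 3/4 < 1 makes the ring Euclidean, and the same bound drives the Gauss
    reduction below. *)
Lemma Oth_round z (N : int) : z \in Oth -> N != 0 ->
  exists2 q, q \in Oth & exists k : int,
    [/\ (z - q * N%:~R) * (z - q * N%:~R)^* = k%:~R, 0 <= k & 4 * k <= 3 * (N * N)].
Proof.
move=> /OthP[a [b ->]] N0; have [p hp] := int_round a N0; have [q hq] := int_round b N0.
exists (@Zth C p q); first by apply/OthP; exists p, q.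
have -> : @Zth C a b - @Zth C p q * N%:~R = @Zth C (a - p * N) (b - q * N).
  by rewrite /Zth !(rmorphB, rmorphM) /=; ring.
rewrite Zth_norm; eexists; split; first reflexivity.
  by have := sqr_ge0 (a - p * N); have := sqr_ge0 (b - q * N); rewrite !expr2; lia.
by lia.
Qed.

Lemma Oth_euclid x y : x \in Oth -> y \in Oth -> y != 0 ->
  exists2 q, q \in Oth & (x - q * y) * (x - q * y)^* < y * y^*.
Proof.
move=> xO yO y0; have [n yn] := Oth_normN yO.
have n0 : n%:R != 0 :> C by rewrite -yn mulf_neq0 ?conjC_eq0.
(* The quotient x/y is rewritten with the integer denominator n, the norm of y. *)
have [||q qO [k [kE k0 kN]]] := @Oth_round (x * y^*) n.
- by rewrite rpredM ?Oth_conj.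
- by move: n0; rewrite pnatr_eq0; lia.
exists q => //; rewrite -(ltr_pM2r (x := y * y^*)) ?mul_conjC_gt0 //.
have -> : (x - q * y) * (x - q * y)^* * (y * y^*)
   = (x * y^* - q * n%:R) * (x * y^* - q * n%:R)^*.
  by rewrite -yn !(conjCD, conjCM, conjCN, conjCK); ring.
rewrite kE yn -natrM pmulrn ltr_int.
by move: n0; rewrite pnatr_eq0; nia.
Qed.

(** Euclid's algorithm, by induction on the norm of [b]. The Bezout relation is stated for the
    cofactors [s], [t] rather than for [g], so that it survives when [a] and [b] both vanish. *)
Lemma Oth_bezout2 a b : a \in Oth -> b \in Oth ->
  exists g s t p q, [/\ [/\ g \in Oth, s \in Oth, t \in Oth, p \in Oth & q \in Oth],
    a = g * s, b = g * t & p * s + q * t = 1].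
Proof.
move=> aO bO; have [n] := Oth_normN bO.
elim/ltn_ind: n a b aO bO => n IH a b aO bO bn.
have [b0|b0] := eqVneq b 0.
  exists a, 1, 0, 1, 0; rewrite ?b0 !rpred0 ?rpred1 ?aO.
  by split; rewrite ?mulr1 ?mulr0 ?mul0r ?addr0.
have [q qO rl] := Oth_euclid aO bO b0.
have rO : a - q * b \in Oth by rewrite rpredB ?rpredM.
have [m rm] := Oth_normN rO.
have mn : (m < n)%N by move: rl; rewrite rm bn ltr_nat.
have [g [s [t [p [q' [[gO sO tO pO q'O] bE rE e]]]]]] := IH m mn b _ bO rO rm.
exists g, (q * s + t), s, q', (p - q' * q); split.
- by split; solve_Oth.
- by rewrite mulrDr -rE mulrCA -bE addrC subrK.
- exact: bE.
- by rewrite -e; ring.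
Qed.

Lemma Oth_bezout3 a b c : a \in Oth -> b \in Oth -> c \in Oth ->
  exists g x y z p q r, [/\ g \in Oth, [/\ x \in Oth, y \in Oth & z \in Oth],
    [/\ p \in Oth, q \in Oth & r \in Oth],
    [/\ a = g * x, b = g * y & c = g * z] & p * x + q * y + r * z = 1].
Proof.
move=> aO bO cO.
have [g [s [t [p [q [[gO sO tO pO qO] aE bE e]]]]]] := Oth_bezout2 aO bO.
have [h [u [v [p' [q' [[hO uO vO p'O q'O] gE cE e']]]]]] := Oth_bezout2 gO cO.
exists h, (u * s), (u * t), v, (p' * p), (p' * q), q'; split; solve_Oth.
- by split; solve_Oth.
- by split; solve_Oth.
- by split; rewrite // ?aE ?bE gE mulrA.
- by rewrite -e' -[p' * u]mulr1 -e; ring.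
Qed.

End Bezout.

(** * Coordinates, the Hermitian form, integral matrices and the cross product *)

Section Vectors.
Variable C : numClosedFieldType.
Local Notation Oth := (@Oth C).
Local Notation J := (@J C).
Implicit Types (u v w x y : 'cV[C]_3) (A B M : 'M[C]_3).

Lemma cvec3P v : exists a b c, v = cvec3 a b c.
Proof.
exists (v ord0 0), (v (inord 1) 0), (v (inord 2) 0); apply/colP => i; rewrite mxE.
by case: i => [[|[|[|//]]] h] /=; congr (v _ _); apply: val_inj; rewrite /= ?inordK.
Qed.

Lemma cvec3_inj (a b c a' b' c' : C) :
  cvec3 a b c = cvec3 a' b' c' -> [/\ a = a', b = b' & c = c'].
Proof.
move=> /colP h; have := h ord0; have := h (inord 1); have := h (inord 2).
by rewrite !mxE !inordK.
Qed.

Lemma scale_cvec3 k (a b c : C) : k *: cvec3 a b c = cvec3 (k * a) (k * b) (k * c).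
Proof. by apply/colP => -[[|[|[|//]]] h]; rewrite !mxE. Qed.

Lemma add_cvec3 (a b c a' b' c' : C) :
  cvec3 a b c + cvec3 a' b' c' = cvec3 (a + a') (b + b') (c + c').
Proof. by apply/colP => -[[|[|[|//]]] h]; rewrite !mxE. Qed.

Lemma opp_cvec3 (a b c : C) : - cvec3 a b c = cvec3 (- a) (- b) (- c).
Proof. by apply/colP => -[[|[|[|//]]] h]; rewrite !mxE. Qed.

Lemma cvec3_0 : 0 = cvec3 0 0 0 :> 'cV[C]_3.
Proof. by apply/colP => -[[|[|[|//]]] h]; rewrite !mxE. Qed.

Definition cvec3E := (scale_cvec3, add_cvec3, opp_cvec3).

Lemma hformE (a b c a' b' c' : C) :
  hform (cvec3 a b c) (cvec3 a' b' c') = a * c'^* + b * b'^* + c * a'^*.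
Proof.
rewrite /hform !mxE !big_ord_recl big_ord0 !mxE !big_ord_recl !big_ord0 !mxE /=.
by rewrite /=; ring.
Qed.

Lemma hform_conj v w : (hform v w)^* = hform w v.
Proof.
have [a [b [c ->]]] := cvec3P v; have [p [q [r ->]]] := cvec3P w.
by rewrite !hformE !conjCD !conjCM !conjCK; ring.
Qed.

Lemma hformDl u v w : hform (u + v) w = hform u w + hform v w.
Proof. by rewrite /hform mulmxDr mxE. Qed.

Lemma hformZl k v w : hform (k *: v) w = k * hform v w.
Proof. by rewrite /hform -scalemxAr mxE. Qed.

Lemma hformDr u v w : hform u (v + w) = hform u v + hform u w.
Proof. by rewrite -hform_conj hformDl conjCD !hform_conj. Qed.

Lemma hformZr k v w : hform v (k *: w) = k^* * hform v w.
Proof. by rewrite -hform_conj hformZl conjCM hform_conj. Qed.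

Lemma hform_unitary A v w : A \in @unitaryJ C -> hform (A *m v) (A *m w) = hform v w.
Proof.
rewrite inE => /andP[_ /eqP hA].
by rewrite /hform trmx_mul map_mxM /= -[in RHS]hA !mulmxA.
Qed.

Lemma unitaryJ_of_gram A : A ^t* *m J *m A = J -> A \in @unitaryJ C.
Proof.
move=> h; rewrite inE h eqxx andbT.
suff /mulmx1_unit[] : (J *m A^t* *m J) *m A = 1%:M by [].
by rewrite -!mulmxA [A^t* *m _]mulmxA h J_sqr.
Qed.

Lemma invmx_unitary A : A \in @unitaryJ C -> invmx A = J *m A^t* *m J.
Proof.
rewrite inE => /andP[uA /eqP hA].
have e : J *m A^t* *m J *m A = 1%:M by rewrite -!mulmxA [A^t* *m _]mulmxA hA J_sqr.
by rewrite -[RHS]mulmx1 -(mulmxV uA) mulmxA e mul1mx.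
Qed.

Definition mat3 u v w : 'M[C]_3 := \matrix_(i, j) [:: u; v; w]`_j i 0.

Lemma mat3P A : exists u v w, A = mat3 u v w.
Proof.
exists (col ord0 A), (col (inord 1) A), (col (inord 2) A).
apply/matrixP => i j; rewrite !mxE.
by case: j => [[|[|[|//]]] h]; rewrite /= mxE; congr (A _ _); apply: val_inj; rewrite /= ?inordK.
Qed.

Lemma mat3_cvec3 u v w a b c : mat3 u v w *m cvec3 a b c = a *: u + b *: v + c *: w.
Proof.
apply/colP => i; rewrite !mxE !big_ord_recl big_ord0 !mxE /=.
by ring.
Qed.

Lemma mul_mat3 A u v w : A *m mat3 u v w = mat3 (A *m u) (A *m v) (A *m w).
Proof.
apply/matrixP => i j; rewrite !mxE.
by case: j => [[|[|[|//]]] h]; rewrite /= !mxE; apply: eq_bigr => k _; rewrite mxE.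
Qed.

Lemma gram_mat3E u v w (i j : 'I_3) :
  (mat3 u v w ^t* *m J *m mat3 u v w) i j = hform ([:: u; v; w]`_j) ([:: u; v; w]`_i).
Proof.
have -> : [:: u; v; w]`_j = col j (mat3 u v w) by apply/colP => k; rewrite !mxE.
have -> : [:: u; v; w]`_i = col i (mat3 u v w) by apply/colP => k; rewrite !mxE.
rewrite /hform tr_col map_row -!row_mul.
by rewrite !mxE; apply: eq_bigr => k _; rewrite !mxE.
Qed.

(** The Gram matrix of the columns has to be [J]; Hermitian symmetry reduces its nine entries to six
    conditions. *)
Lemma unitary_mat3 u v w :
  hform u u = 0 -> hform u v = 0 -> hform u w = 1 -> hform v v = 1 ->
  hform v w = 0 -> hform w w = 0 -> mat3 u v w \in @unitaryJ C.
Proof.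
move=> uu uv uw vv vw ww; apply: unitaryJ_of_gram; apply/matrixP => i j.
have vu : hform v u = 0 by rewrite -hform_conj uv conjC0.
have wu : hform w u = 1 by rewrite -hform_conj uw conjC1.
have wv : hform w v = 0 by rewrite -hform_conj vw conjC0.
rewrite gram_mat3E mxE.
by case: i => [[|[|[|//]]] ?]; case: j => [[|[|[|//]]] ?].
Qed.

Definition Omx m n (A : 'M[C]_(m, n)) := forall i j, A i j \in Oth.

Lemma Omx_mul m n p (A : 'M[C]_(m, n)) (B : 'M[C]_(n, p)) :
  Omx A -> Omx B -> Omx (A *m B).
Proof. by move=> hA hB i j; rewrite mxE rpred_sum // => k _; rewrite rpredM. Qed.

Lemma Omx_conjt m n (A : 'M[C]_(m, n)) : Omx A -> Omx (A ^t*).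
Proof. by move=> hA i j; rewrite !mxE; apply: Oth_conj. Qed.

Lemma Omx_J : Omx J.
Proof. by move=> i j; rewrite mxE rpred_nat. Qed.

Lemma Omx_cvec3 (a b c : C) : a \in Oth -> b \in Oth -> c \in Oth -> Omx (cvec3 a b c).
Proof. by move=> ? ? ? [[|[|[|//]]] h] j; rewrite !mxE. Qed.

Lemma Omx_cvec3P v : Omx v ->
  exists a b c, [/\ v = cvec3 a b c, a \in Oth, b \in Oth & c \in Oth].
Proof.
have [a [b [c ->]]] := cvec3P v => h; exists a, b, c; split => //.
- by have := h ord0 0; rewrite mxE.
- by have := h (inord 1) 0; rewrite mxE inordK.
- by have := h (inord 2) 0; rewrite mxE inordK.
Qed.

Lemma Omx_mat3 u v w : Omx u -> Omx v -> Omx w -> Omx (mat3 u v w).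
Proof. by move=> ? ? ? i [[|[|[|//]]] h]; rewrite !mxE. Qed.

Lemma Omx_hform v w : Omx v -> Omx w -> hform v w \in Oth.
Proof.
by move=> hv hw; apply: (Omx_mul (Omx_mul (Omx_conjt hw) Omx_J) hv).
Qed.

Lemma Omx_inv A : A \in @unitaryJ C -> Omx A -> Omx (invmx A).
Proof.
move=> /invmx_unitary -> hA.
exact: Omx_mul (Omx_mul Omx_J (Omx_conjt hA)) Omx_J.
Qed.

(** The inverse of a unitary matrix is built from [J] and the conjugate transpose, so its
    integrality follows from that of [A]. *)
Lemma Omx_GL3 A : A \in @unitaryJ C ->
  (GL3_over (@ring_of_integers C 2) A) <-> Omx A.
Proof.
move=> uA; split=> [[_ h] i j|h].
  by apply/ring_of_integersE; case: (h i j).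
split; first by move: uA; rewrite inE => /andP[].
by move=> i j; split; apply/ring_of_integersE => //; apply: Omx_inv.
Qed.

(* The Hermitian cross product: [hform y (hcross v w)] is the determinant of [y], [v], [w]. *)
Definition hcross v w : 'cV[C]_3 :=
  let a := v ord0 0 in let b := v (inord 1) 0 in let c := v (inord 2) 0 in
  let p := w ord0 0 in let q := w (inord 1) 0 in let r := w (inord 2) 0 in
  cvec3 (a * q - b * p)^* (c * p - a * r)^* (b * r - c * q)^*.

Lemma hcrossE (a b c p q r : C) : hcross (cvec3 a b c) (cvec3 p q r) =
  cvec3 (a * q - b * p)^* (c * p - a * r)^* (b * r - c * q)^*.
Proof. by rewrite /hcross !mxE /= !inordK. Qed.

(** The last identity is Lagrange's: the norm of the cross product is minus the Gram determinant of
    [v] and [w], the sign being that of det J = -1. *)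
Lemma hcross_perp v w : [/\ hform (hcross v w) v = 0, hform (hcross v w) w = 0 &
  hform (hcross v w) (hcross v w) = hform v w * hform w v - hform v v * hform w w].
Proof.
have [a [b [c ->]]] := cvec3P v; have [p [q [r ->]]] := cvec3P w.
rewrite hcrossE !hformE !(conjCD, conjCM, conjCN, conjCK).
by split; ring.
Qed.

End Vectors.

(** * Mirrors and the unitary matrices fixing them pointwise *)

Section Mirrors.
Variable C : numClosedFieldType.
Local Notation J := (@J C).
Implicit Types (u v w x y : 'cV[C]_3) (A B M : 'M[C]_3).

(** The Gram matrix is diagonal and invertible, which exhibits a left inverse. *)
Lemma mat3_unit u v w : hform u v = 0 -> hform u w = 0 -> hform v w = 0 ->
  hform u u != 0 -> hform v v != 0 -> hform w w != 0 -> mat3 u v w \in unitmx.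
Proof.
move=> uv uw vw u0 v0 w0.
have vu : hform v u = 0 by rewrite -hform_conj uv conjC0.
have wu : hform w u = 0 by rewrite -hform_conj uw conjC0.
have wv : hform w v = 0 by rewrite -hform_conj vw conjC0.
pose d := \row_i (hform ([:: u; v; w]`_i) ([:: u; v; w]`_i))^-1 : 'rV[C]_3.
suff /mulmx1_unit[] : (diag_mx d *m (mat3 u v w ^t* *m J)) *m mat3 u v w = 1%:M by [].
rewrite -mulmxA mul_diag_mx; apply/matrixP => i j.
rewrite mxE gram_mat3E !mxE.
by case: i => [[|[|[|//]]] ?]; case: j => [[|[|[|//]]] ?] /=;
  rewrite ?(vu, wu, wv, uv, uw, vw, mulr0) ?mulVf.
Qed.

Lemma ortho_decomp u v w y : hform u v = 0 -> hform u w = 0 -> hform v w = 0 ->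
  hform u u != 0 -> hform v v != 0 -> hform w w != 0 ->
  y = (hform y u / hform u u) *: u + (hform y v / hform v v) *: v
    + (hform y w / hform w w) *: w.
Proof.
move=> uv uw vw u0 v0 w0.
have vu : hform v u = 0 by rewrite -hform_conj uv conjC0.
have wu : hform w u = 0 by rewrite -hform_conj uw conjC0.
have wv : hform w v = 0 by rewrite -hform_conj vw conjC0.
have M1 := mat3_unit uv uw vw u0 v0 w0.
have [a [b [c e]]] := cvec3P (invmx (mat3 u v w) *m y).
have -> : y = a *: u + b *: v + c *: w by rewrite -mat3_cvec3 -e mulKVmx.
rewrite !(hformDl, hformZl) uv uw vw vu wu wv.
by rewrite !(mulr0, addr0, add0r) !mulfK.
Qed.

Lemma mirror_frame w : 0 < hform w w -> exists v0 u,
  [/\ [/\ hform v0 u = 0, hform v0 w = 0 & hform u w = 0],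
      hform v0 v0 < 0, 0 < hform u u,
      hform (v0 + u) (v0 + u) < 0 & hform (v0 - u) (v0 - u) < 0].
Proof.
move=> w0.
pose z : 'cV[C]_3 := cvec3 1 0 (-1).
have zz : hform z z = - 2 by rewrite hformE conjCN conjC1 conjC0; ring.
pose n := hform w w; have n0 : n != 0 by rewrite gt_eqF.
have nr : n^* = n by exact: hform_conj.
(* Projecting the negative vector [z] onto the polar of [w] only lowers its norm. *)
pose v := z - (hform z w / n) *: w.
have vw : hform v w = 0.
  by rewrite /v -scaleN1r hformDl !hformZl divfK // mulN1r subrr.
have vv : hform v v = - 2 - hform z w * (hform z w)^* / n.
  rewrite {2}/v -scaleN1r hformDr !hformZr vw !mulr0 addr0.
  rewrite /v -scaleN1r hformDl !hformZl zz -(hform_conj z w).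
  by field.
have v0 : hform v v < 0.
  rewrite vv subr_lt0; apply: (@lt_le_trans _ _ 0); first by rewrite oppr_lt0 ltr0n.
  by rewrite divr_ge0 ?mul_conjC_ge0 // ltW.
have [uv uw uu] := hcross_perp v w; move: (hcross v w) uv uw uu => u uv uw uu.
have wv : hform w v = 0 by rewrite -hform_conj vw conjC0.
have vu : hform v u = 0 by rewrite -hform_conj uv conjC0.
rewrite vw mul0r add0r -mulNr in uu; rewrite -/n in uu.
have cK : (1 + n)^* = 1 + n by rewrite conjCD conjC1 nr.
have K0 : 0 < 1 + n by rewrite addr_gt0.
(* The norm of [u] is -n times that of [v]; the factor 1 + n makes the norm of the sum (1 + n)^2 - n
   = 1 + n + n^2 times that of [v], hence negative. *)
exists ((1 + n) *: v), u.
have neg : hform ((1 + n) *: v) ((1 + n) *: v) + hform u u < 0.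
  rewrite hformZl hformZr cK uu.
  have -> : (1 + n) * ((1 + n) * hform v v) + - hform v v * n
      = (1 + n + n * n) * hform v v by ring.
  by rewrite pmulr_rlt0 // !addr_gt0 // mulr_gt0.
have h1 : hform ((1 + n) *: v) u = 0 by rewrite hformZl vu mulr0.
have h2 : hform u ((1 + n) *: v) = 0 by rewrite hformZr uv mulr0.
split.
- by split => //; rewrite hformZl vw mulr0.
- by rewrite hformZl hformZr cK !pmulr_rlt0.
- by rewrite uu mulr_gt0 // oppr_gt0.
- by rewrite hformDl !hformDr h1 h2 addr0 add0r.
- move: neg h1 h2; move: (_ *: v) => V neg h1 h2.
  by rewrite -scaleN1r hformDl !hformDr !hformZl !hformZr h1 h2 conjCN conjC1
    !mulr0 mulrA mulrNN mulr1 mul1r addr0 add0r.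
Qed.

Lemma line_inj v v' : line v = line v' -> exists c, v = c *: v'.
Proof.
move=> h; have : line v v by exists 1 => //; rewrite scale1r.
by rewrite h => -[c _ <-]; exists c.
Qed.

Lemma mirror_line v w : hform v v < 0 -> mirror w (line v) <-> hform v w = 0.
Proof.
move=> v0; split.
  move=> [_ [v' hv' /esym/line_inj[c ->]]].
  by rewrite hformZl hv' mulr0.
by move=> h; split; exists v.
Qed.

Lemma mirrorP w p : mirror w p <-> exists v, [/\ p = line v, hform v v < 0 & hform v w = 0].
Proof.
split=> [[[v /= v0 <-] h]|[v [-> v0 vw]]]; last by apply/mirror_line.
by exists v; split => //; apply/(mirror_line w v0); split => //; exists v.
Qed.

Lemma mirror_scale k w : k != 0 -> mirror (k *: w) = mirror w.
Proof.
move=> k0; apply/seteqP; split => p /mirrorP[v [-> v0 vw]]; apply/mirror_line => //.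
  by move: vw; rewrite hformZr => /eqP; rewrite mulf_eq0 conjC_eq0 (negPf k0) => /eqP.
by rewrite hformZr vw mulr0.
Qed.

Lemma act_mirror (A : UJ C) w :
  [set act (\pi_(PU C) A) p | p in mirror w]%classic = mirror ((A : 'M[C]_3) *m w).
Proof.
have uA := UJmxP A.
apply/seteqP; split => [_ [p /mirrorP[v [-> v0 vw]] <-]|p /mirrorP[v [-> v0 vw]]].
  by rewrite act_line; apply/mirror_line; rewrite hform_unitary.
have [v' vE] : exists v', v = (A : 'M[C]_3) *m v'.
  by exists (invmx A *m v); rewrite mulKVmx // UJ_unit.
exists (line v'); last by rewrite act_line -vE.
by rewrite vE !hform_unitary // in v0 vw; apply/(mirror_line w v0).
Qed.

(** The points [v] and [v + u] of the mirror already span the polar plane of [w], so [w'] has no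
    component along [v] or [u]. *)
Lemma mirror_inj w w' : 0 < hform w w -> mirror w = mirror w' -> exists c, w' = c *: w.
Proof.
move=> w0 h; have [v [u [[vu vw uw] v0 u0 vpu _]]] := mirror_frame w0.
have vw' : hform v w' = 0 by apply/mirror_line; rewrite // -h; apply/mirror_line.
have : hform (v + u) w' = 0.
  by apply/mirror_line; rewrite // -h; apply/mirror_line; rewrite // hformDl vw uw addr0.
rewrite hformDl vw' add0r => uw'.
exists (hform w' w / hform w w).
rewrite [LHS](@ortho_decomp v u w) ?(lt_eqF v0) ?(gt_eqF u0) ?(gt_eqF w0) //.
by rewrite -!(hform_conj _ w') vw' uw' conjC0 !mul0r !scale0r !add0r.
Qed.

Lemma fixed_line (A : UJ C) w v : fixes_pointwise (\pi_(PU C) A) (mirror w) ->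
  hform v v < 0 -> hform v w = 0 -> exists c, (A : 'M[C]_3) *m v = c *: v.
Proof.
move=> fA v0 vw; apply: line_inj; rewrite -act_line; apply: fA.
exact/mirror_line.
Qed.

(** Three distinct eigenlines [v], [v + u], [v - u] in the polar plane force [A] to be a scalar [l]
    there. By unitarity [w] is then an eigenvector as well, and both eigenvalues have modulus 1. *)
Lemma fixes_mirror_form (A : UJ C) w : 0 < hform w w ->
  fixes_pointwise (\pi_(PU C) A) (mirror w) ->
  exists l m : C, [/\ l * l^* = 1, m * m^* = 1 & forall y,
    (A : 'M[C]_3) *m y = l *: y + ((m - l) / hform w w * hform y w) *: w].
Proof.
move=> w0 fA; have [v [u [[vu vw uw] v0 u0 vpu vmu]]] := mirror_frame w0.
have uA := UJmxP A.
have nv : hform v v != 0 by rewrite lt_eqF.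
have nu : hform u u != 0 by rewrite gt_eqF.
have nw : hform w w != 0 by rewrite gt_eqF.
have uv : hform u v = 0 by rewrite -hform_conj vu conjC0.
have [l Av] := fixed_line fA v0 vw.
have [|a Ap] := fixed_line fA vpu; first by rewrite hformDl vw uw addr0.
have [|b Am] := fixed_line fA vmu.
  by rewrite -scaleN1r hformDl hformZl vw uw mulr0 addr0.
(* The component of this relation along [u] gives a = b, the one along [v] gives l = a. *)
have e : a *: (v + u) + b *: (v - u) = 2 *: (l *: v).
  by rewrite -Ap -Am -mulmxDr addrACA subrr addr0 mulmxDr Av scaler_nat mulr2n.
have ab : a = b.
  have := congr1 (fun x => @hform C x u) e.
  rewrite -!scaleN1r !(hformDl, hformZl) vu !(mulr0, add0r) mulN1r mulrN -mulrBl.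
  by move=> /eqP; rewrite mulf_eq0 (negPf nu) orbF subr_eq0 => /eqP.
have la : l = a.
  have := congr1 (fun x => @hform C x v) e.
  rewrite -!scaleN1r !(hformDl, hformZl) uv !(mulr0, addr0) -ab -mulrDl mulrA.
  move=> /(mulIf nv) h; have : (2 : C) * l = 2 * a by rewrite -h; ring.
  by move=> /mulfI; apply; rewrite pnatr_eq0.
have Au : (A : 'M[C]_3) *m u = l *: u.
  have -> : u = (v + u) - v by rewrite addrC addKr.
  by rewrite -la in Ap; rewrite mulmxBr Ap Av scalerBr.
have ll : l * l^* = 1.
  have := hform_unitary v v uA; rewrite Av hformZl hformZr mulrA => h.
  by apply: (mulIf nv); rewrite h mul1r.
have l0 : l^* != 0 by apply: contra_eq_neq ll => ->; rewrite mulr0 eq_sym oner_neq0.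
have Aw : exists m, (A : 'M[C]_3) *m w = m *: w.
  exists (hform (A *m w) w / hform w w).
  have wv : hform w v = 0 by rewrite -hform_conj vw conjC0.
  have wu : hform w u = 0 by rewrite -hform_conj uw conjC0.
  (* Since [A] is unitary, the image of [w] stays orthogonal to eigenvectors orthogonal to [w]. *)
  have o z : (A : 'M[C]_3) *m z = l *: z -> hform w z = 0 -> hform (A *m w) z = 0.
    move=> Az wz; apply: (mulfI l0); rewrite -hformZr -Az hform_unitary // wz mulr0.
    by [].
  rewrite [LHS](@ortho_decomp v u w) //.
  by rewrite (o v) // (o u) // !mul0r !scale0r !add0r.
have [m Am'] := Aw; exists l, m; split => // [|y].
  have := hform_unitary w w uA; rewrite Am' hformZl hformZr mulrA => h.
  by apply: (mulIf nw); rewrite h mul1r.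
rewrite {1 2}[y](@ortho_decomp v u w) // !mulmxDr -!scalemxAr Av Au Am'.
rewrite !scalerDr -!addrA; congr (_ + _); first by rewrite !scalerA mulrC.
congr (_ + _); first by rewrite !scalerA mulrC.
by rewrite !scalerA -scalerDl; congr (_ *: _); field.
Qed.

End Mirrors.

(** * Primitive vectors and integral reflections *)

Lemma int_sq_cases (b : int) : [\/ b = 0, b = 1, b = -1 | 4 <= b * b].
Proof.
have : b <= -2 \/ b = -1 \/ b = 0 \/ b = 1 \/ 2 <= b by lia.
by case=> [?|[->|[->|[->|?]]]]; [constructor 4; nia | constructor 3 | constructor 1 |
  constructor 2 | constructor 4; nia].
Qed.
Lemma int_norm1 (a b : int) : a * a + 2 * (b * b) = 1 -> b = 0 /\ (a = 1 \/ a = -1).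
Proof.
move=> h; have := sqr_ge0 a; rewrite expr2.
by case: (int_sq_cases a) (int_sq_cases b) h => [->|->|->|?] [->|->|->|?]; lia.
Qed.
Lemma int_norm2 (a b : int) : a * a + 2 * (b * b) = 2 -> a = 0 /\ (b = 1 \/ b = -1).
Proof.
move=> h; have := sqr_ge0 b; rewrite expr2.
by case: (int_sq_cases a) (int_sq_cases b) h => [->|->|->|?] [->|->|->|?]; lia.
Qed.

Lemma int_divisor2 (a p : int) : 0 < p -> 2 = a * p -> p = 1 \/ p = 2.
Proof.
move=> p0 e; have : a <= 0 \/ 1 <= a by lia.
case=> a0; first by nia.
have : p <= 2; [by nia | by lia].
Qed.

Section IntegralReflections.
Variable C : numClosedFieldType.
Local Notation Oth := (@Oth C).
Local Notation theta := (@theta C).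
Implicit Types (u v w x y : 'cV[C]_3) (A B M : 'M[C]_3).

(** Primitivity as a pairing with value 1: this form is visibly invariant under the group, and the
    scalar of an integral multiple [k *: w] is recovered by pairing with [p]. *)
Definition primitive_vec w :=
  Omx w /\ exists2 p : 'cV[C]_3, Omx p & hform w p = 1.

Lemma primitive_part v : Omx v -> v != 0 ->
  exists g w, [/\ g \in Oth, g != 0, primitive_vec w & v = g *: w].
Proof.
move=> /Omx_cvec3P[a [b [c [-> aO bO cO]]]] v0.
have [g [x [y [z [p [q [r [gO [xO yO zO] [pO qO rO] [aE bE cE] e]]]]]]]] := Oth_bezout3 aO bO cO.
have E : cvec3 a b c = g *: cvec3 x y z by rewrite scale_cvec3 aE bE cE.
exists g, (cvec3 x y z); split => //.
  by apply: contraNneq v0 => g0; rewrite E g0 scale0r.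
split; first exact: Omx_cvec3.
(* The form exchanges the outer coordinates and conjugates its second argument, hence the reversed
   order and the conjugates. *)
exists (cvec3 r^* q^* p^*); first by apply: Omx_cvec3; solve_Oth.
by rewrite hformE !conjCK -e; ring.
Qed.

Lemma primitive_mul A w : A \in @unitaryJ C -> Omx A -> primitive_vec w -> primitive_vec (A *m w).
Proof.
move=> uA oA [ow [p op wp]]; split; first exact: Omx_mul.
by exists (A *m p); [exact: Omx_mul | rewrite hform_unitary].
Qed.

Lemma primitive_scale k w : primitive_vec w -> Omx (k *: w) -> k \in Oth.
Proof.
move=> [ow [p op wp]] h; have := Omx_hform h op.
by rewrite hformZl wp mulr1.
Qed.

Lemma Oth_unit_norm l : l \in Oth -> l * l^* = 1 -> l = 1 \/ l = -1.
Proof.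
move=> /OthP[a [b ->]]; rewrite Zth_norm -[RHS]/((Posz 1)%:~R) => /intr_inj h.
have [b0] := int_norm1 h.
by case=> ->; [left|right]; rewrite b0 /Zth mul0r addr0.
Qed.

Lemma Oth_norm2 l : l \in Oth -> l * l^* = 2 -> l = theta \/ l = - theta.
Proof.
move=> /OthP[a [b ->]]; rewrite Zth_norm -[RHS]/((Posz 2)%:~R) => /intr_inj h.
have [a0] := int_norm2 h.
by case=> ->; [left|right]; rewrite a0 /Zth add0r ?mul1r ?mulN1r.
Qed.

(** Dividing [v] by its content gives a primitive eigenvector [w]; its image [l *: w] is integral,
    so [l] is. *)
Lemma integral_eigenvalue A l v : Omx A -> A *m v = l *: v -> Omx v -> v != 0 -> l \in Oth.
Proof.
move=> oA Av ov v0; have [g [w [gO g0 pw vE]]] := primitive_part ov v0.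
apply: (primitive_scale pw).
have -> : l *: w = A *m w.
  apply: (scalerI g0); rewrite scalerA mulrC -scalerA -vE -Av vE.
  by rewrite -scalemxAr.
by apply: Omx_mul => //; case: pw.
Qed.

Lemma fixes_mirror_integral (A : UJ C) w : Omx A -> 0 < hform w w ->
  fixes_pointwise (\pi_(PU C) A) (mirror w) ->
  exists2 e : C, e = 1 \/ e = -1 &
    ((A : 'M[C]_3) = e *: 1%:M) \/
    (forall y, (A : 'M[C]_3) *m y = e *: (y - (2 / hform w w * hform y w) *: w)).
Proof.
move=> oA w0 /(fixes_mirror_form w0)[l [m [ll mm Ay]]].
set k := (m - l) / _ in Ay.
have nw : hform w w != 0 by rewrite gt_eqF.
have [w1 [w2 [w3 wE]]] := cvec3P w.
have o1 : Omx (cvec3 1 0 0 : 'cV[C]_3) by apply: Omx_cvec3; solve_Oth.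
have o2 : Omx (cvec3 0 1 0 : 'cV[C]_3) by apply: Omx_cvec3; solve_Oth.
have o3 : Omx (cvec3 0 0 1 : 'cV[C]_3) by apply: Omx_cvec3; solve_Oth.
(* As [w] is an arbitrary complex vector, the integrality of [A] is available only through these
   nine entries. *)
have A1 : (A : 'M[C]_3) *m cvec3 1 0 0 = cvec3 (l + k * w3^* * w1) (k * w3^* * w2) (k * w3^* * w3).
  by rewrite Ay wE hformE !cvec3E; congr cvec3; ring.
have A2 : (A : 'M[C]_3) *m cvec3 0 1 0 = cvec3 (k * w2^* * w1) (l + k * w2^* * w2) (k * w2^* * w3).
  by rewrite Ay wE hformE !cvec3E; congr cvec3; ring.
have A3 : (A : 'M[C]_3) *m cvec3 0 0 1 = cvec3 (k * w1^* * w1) (k * w1^* * w2) (l + k * w1^* * w3).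
  by rewrite Ay wE hformE !cvec3E; congr cvec3; ring.
have := Omx_mul oA o1; rewrite A1 => /Omx_cvec3P[? [? [? [/cvec3_inj[<- <- <-] a11 a21 a31]]]].
have := Omx_mul oA o2; rewrite A2 => /Omx_cvec3P[? [? [? [/cvec3_inj[<- <- <-] a12 a22 a32]]]].
have := Omx_mul oA o3; rewrite A3 => /Omx_cvec3P[? [? [? [/cvec3_inj[<- <- <-] a13 a23 a33]]]].
(* [v] is an integral vector of the polar hyperplane, on which [A] acts as [l]. *)
have lO : l \in Oth.
  have [x3|x3] := eqVneq (k * w3) 0.
    by move: a33; rewrite mulrAC x3 mul0r addr0.
  pose v : 'cV[C]_3 := cvec3 (k * w2^* * w3) (- (k * w3^* * w3)) 0.
  have Av : (A : 'M[C]_3) *m v = l *: v.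
    rewrite Ay (_ : hform v w = 0) ?mulr0 ?scale0r ?addr0 //.
    by rewrite /v wE hformE; ring.
  have [v0|v0] := eqVneq v 0; last first.
    by apply: integral_eigenvalue oA Av _ v0; apply: Omx_cvec3; solve_Oth.
  move: v0; rewrite /v cvec3_0 => /cvec3_inj[_ /eqP + _].
  rewrite oppr_eq0 mulrAC mulf_eq0 (negPf x3) /= => /eqP w30.
  by rewrite w30 mulr0 mul0r addr0 in a11.
have mO : m \in Oth.
  (* The trace of [A] is 2l + m. *)
  have -> : m = (l + k * w3^* * w1) + (l + k * w2^* * w2) + (l + k * w1^* * w3) - 2 * l.
    have : k * hform w w = m - l by rewrite /k divfK.
    by rewrite wE hformE => h; apply: (addIr (- l)); rewrite -h; ring.
  by solve_Oth.
have l1 := Oth_unit_norm lO ll; have m1 := Oth_unit_norm mO mm.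
exists l => //; have [ml|ml] := eqVneq m l.
  left; have k0 : k = 0 by rewrite /k ml subrr mul0r.
  rewrite k0 in A1 A2 A3.
  have [u [v [z AE]]] := mat3P A.
  rewrite AE in A1 A2 A3; move: A1 A2 A3.
  rewrite !mat3_cvec3 AE !mul0r !addr0 !scale0r !scale1r !addr0 !add0r => -> -> ->.
  apply/matrixP => i j; rewrite !mxE.
  by case: i => [[|[|[|//]]] ?]; case: j => [[|[|[|//]]] ?]; rewrite /= mxE /= ?mulr1 ?mulr0.
right=> y; have mE : m = - l.
  by move: ml; case: l1 m1 => -> [] ->; rewrite ?eqxx ?opprK.
rewrite Ay scalerBr scalerA; congr (_ + _); rewrite -scaleNr /k mE.
by congr (_ *: _); ring.
Qed.

(** For integral y the displacement 2 <y,w>/<w,w> w is integral. A nonzero one yields a primitive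
    multiple w' of w; taking for y a vector that pairs to 1 with w' shows that 2/<w',w'> lies in
    Z[theta]. *)
Lemma reflection_primitive (A : UJ C) w (e : C) : Omx A -> 0 < hform w w -> e = 1 \/ e = -1 ->
  (forall y, (A : 'M[C]_3) *m y = e *: (y - (2 / hform w w * hform y w) *: w)) ->
  exists k w', [/\ k != 0, w = k *: w', primitive_vec w' & hform w' w' = 1 \/ hform w' w' = 2].
Proof.
move=> oA w0 e1 Ay.
have nw : hform w w != 0 by rewrite gt_eqF.
have ee : e * e = 1 by case: e1 => ->; rewrite ?mulrNN mulr1.
have eO : e \in Oth by case: e1 => ->; solve_Oth.
have oy y : Omx y -> Omx ((2 / hform w w * hform y w) *: w).
  move=> Oy i j.
  have -> : ((2 / hform w w * hform y w) *: w) i j = y i j - e * (A *m y) i j.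
    by rewrite Ay [(_ *: _ : 'cV_3) i j in RHS]mxE mulrA ee mul1r !mxE; ring.
  have := Oy i j; have := Omx_mul oA Oy i j => ? ?.
  by solve_Oth.
have [z oz wz] : exists2 z, Omx z & hform z w != 0.
  have [w1 [w2 [w3 wE]]] := cvec3P w.
  have o1 : Omx (cvec3 1 0 0 : 'cV[C]_3) by apply: Omx_cvec3; solve_Oth.
  have o2 : Omx (cvec3 0 1 0 : 'cV[C]_3) by apply: Omx_cvec3; solve_Oth.
  have o3 : Omx (cvec3 0 0 1 : 'cV[C]_3) by apply: Omx_cvec3; solve_Oth.
  have [h3|h3] := eqVneq (hform (cvec3 1 0 0) w) 0; last by exists (cvec3 1 0 0).
  have [h2|h2] := eqVneq (hform (cvec3 0 1 0) w) 0; last by exists (cvec3 0 1 0).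
  have [h1|h1] := eqVneq (hform (cvec3 0 0 1) w) 0; last by exists (cvec3 0 0 1).
  case/eqP: nw; move: h1 h2 h3; rewrite wE !hformE !(mul1r, mul0r, addr0, add0r) => -> -> ->.
  by rewrite !mulr0 !addr0.
pose c := 2 / hform w w * hform z w.
have c0 : c != 0 by rewrite !mulf_neq0 ?invr_eq0 ?pnatr_eq0.
have cw0 : c *: w != 0.
  rewrite scaler_eq0 (negPf c0) /=; apply: contraNneq nw => ->.
  by rewrite -(scale0r (0 : 'cV_3)) hformZl mul0r.
have [g [w' [gO g0 pw' E]]] := primitive_part (oy z oz) cw0.
have wE : w = (g / c) *: w' by apply: (scalerI c0); rewrite E scalerA mulrCA divff // mulr1.
have gc0 : g / c != 0 by rewrite mulf_neq0 ?invr_eq0.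
move: (g / c) wE gc0 => k wE k0.
have [ow' [p op w'p]] := pw'.
exists k, w'; split => //.
have w'0 : 0 < hform w' w'.
  move: w0; rewrite wE hformZl hformZr mulrA pmulr_rgt0 //.
  by rewrite mul_conjC_gt0.
have [a [b nE]] : exists a b, 2 / hform w' w' = @Zth C a b.
  apply/OthP; apply: (primitive_scale pw').
  have -> : (2 / hform w' w') *: w' = (2 / hform w w * hform p w) *: w; last exact: oy.
  have -> : hform p w = k^* by rewrite wE hformZr -hform_conj w'p conjC1 mulr1.
  rewrite {3}wE scalerA wE hformZl hformZr; congr (_ *: _).
  have kc0 : k^* != 0 by rewrite conjC_eq0.
  have : hform w' w' != 0 by rewrite gt_eqF.
  by move: (hform w' w') (k^*) kc0 => N kc kc0 N0; field; rewrite kc0 k0 N0.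
have [p' [q' nE']] : exists p q, hform w' w' = @Zth C p q.
  by apply/OthP; apply: Omx_hform.
have q0 : q' = 0.
  have := hform_conj w' w'; rewrite nE' conj_Zth => /Zth_inj[_]; clear; lia.
have n' : hform w' w' = p'%:~R by rewrite nE' q0 /Zth mul0r addr0.
have p0 : 0 < p' by move: w'0; rewrite n' ltr0z.
(* The norm of [w'] is a positive integer [p']; comparing rational parts, it divides 2. *)
have : 2 = @Zth C (a * p') (b * p').
  apply: (mulIf (_ : (hform w' w')^-1 != 0)); first by rewrite invr_eq0 gt_eqF.
  rewrite nE n' /Zth !rmorphM /=.
  have : p'%:~R != 0 :> C by rewrite intr_eq0 gt_eqF.
  by move: (p'%:~R : C) theta => P T P0; field.
rewrite [X in X = _](_ : 2 = @Zth C 2 0); last by rewrite /Zth mul0r addr0.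
move=> /Zth_inj[ap _]; rewrite n'.
by case: (int_divisor2 p0 ap) => ->; [left|right]; ring.
Qed.

End IntegralReflections.

(** * Gauss reduction, isotropic vectors and elementary moves of the group *)

Section Orbits.
Variable C : numClosedFieldType.
Local Notation Oth := (@Oth C).
Local Notation theta := (@theta C).
Implicit Types (u v w x y e f : 'cV[C]_3) (A B M : 'M[C]_3).

(** Together with [hcross_swap], this says that the two moves of Gauss reduction keep the cross
    product, and hence the vector [w] polar to the lattice. *)
Lemma hcross_shift k e f : hcross e (f - k *: e) = hcross e f.
Proof.
have [a [b [c ->]]] := cvec3P e; have [p [q [r ->]]] := cvec3P f.
by rewrite !cvec3E !hcrossE; congr (cvec3 _^* _^* _^*); ring.
Qed.

Lemma hcross_swap e f : hcross f (- e) = hcross e f.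
Proof.
have [a [b [c ->]]] := cvec3P e; have [p [q [r ->]]] := cvec3P f.
by rewrite !cvec3E !hcrossE; congr (cvec3 _^* _^* _^*); ring.
Qed.

Lemma hcross0 f : hcross 0 f = 0.
Proof.
have [p [q [r ->]]] := cvec3P f.
by rewrite cvec3_0 hcrossE !mul0r subrr conjC0.
Qed.

Lemma OmxZ k v : k \in Oth -> Omx v -> Omx (k *: v).
Proof. by move=> kO vO i j; rewrite mxE rpredM. Qed.

Lemma OmxD u v : Omx u -> Omx v -> Omx (u + v).
Proof. by move=> uO vO i j; rewrite mxE rpredD. Qed.

Lemma OmxB u v : Omx u -> Omx v -> Omx (u - v).
Proof. by move=> uO vO i j; rewrite !mxE rpredB. Qed.

Lemma Omx_hcross u v : Omx u -> Omx v -> Omx (hcross u v).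
Proof.
move=> /Omx_cvec3P[a [b [c [-> aO bO cO]]]] /Omx_cvec3P[p [q [r [-> pO qO rO]]]].
by rewrite hcrossE; apply: Omx_cvec3; solve_Oth.
Qed.

(** Taking [e] with last coordinate zero, orthogonality to [w] dictates its other coordinates up to
    the gcd [g], which reappears in [f]; the Bezout relation then adjusts the remaining coordinate
    [a]. *)
Lemma Omx_hcross_factor w : Omx w -> exists e f, [/\ Omx e, Omx f & hcross e f = w].
Proof.
move=> /Omx_cvec3P[a [b [c [-> aO bO cO]]]].
have [g [s [t [p [q [[gO sO tO pO qO] cE bE h]]]]]] := Oth_bezout2 (Oth_conj cO) (Oth_conj bO).
exists (cvec3 t (- s) 0), (cvec3 (p * a^*) (q * a^*) (- g)); split.
- by apply: Omx_cvec3; solve_Oth.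
- by apply: Omx_cvec3; solve_Oth.
rewrite hcrossE; congr cvec3.
- rewrite -[RHS]conjCK; congr (_ ^*); rewrite -[RHS]mul1r -h; ring.
- by rewrite -[RHS]conjCK bE; congr (_ ^*); ring.
- by rewrite -[RHS]conjCK cE; congr (_ ^*); ring.
Qed.

Lemma Omx_norm_int v : Omx v -> exists a : int, hform v v = a%:~R.
Proof.
move=> vO; have /OthP[a [b h]] := Omx_hform vO vO; exists a.
have := hform_conj v v; rewrite h conj_Zth => /Zth_inj[_ b0].
have -> : b = 0 by move: b0; clear; lia.
by rewrite /Zth mul0r addr0.
Qed.

(** Here a and c are the norms of the basis vectors, k the squared modulus of their product and n
    the norm of [w]. If ac were nonnegative, a^2 <= ac <= k would contradict k <= 3a^2/4; so a^2 <=
    n - k <= 2, whence a = 1 or -1 and k = 0. *)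
Lemma gauss_stop (a c k n : int) : a != 0 -> 0 <= k -> 4 * k <= 3 * (a * a) ->
  k - a * c = n -> n = 1 \/ n = 2 -> `|a| <= `|c| -> [/\ k = 0, a = 1 \/ a = -1 & c = - (n * a)].
Proof.
move=> a0 k0 ka e n12 ac.
have aac : a * a <= `|a * c| by rewrite normrM -[a * a]ger0_norm ?sqr_ge0 // normrM ler_wpM2l.
have {}e : a * c = k - n by lia.
have kn : a * a <= n - k by rewrite e in aac; lia.
by case: (int_sq_cases a) (a0) kn ka e => [->|->|->|?] //;
  rewrite ?mulN1r ?mul1r => *; split; lia.
Qed.

(* Gauss reduction of the rank two lattice spanned by [e] and [f], the polar lattice of [w]. *)
Lemma isotropic_in_polar w : Omx w -> hform w w = 1 \/ hform w w = 2 ->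
  exists v, [/\ Omx v, v != 0, hform v w = 0 & hform v v = 0].
Proof.
move=> wO wn.
have [n nE n12] : exists2 n : int, hform w w = n%:~R & n = 1 \/ n = 2.
  by case: wn => ->; [exists 1 => //; left | exists 2 => //; right].
have w0 : w != 0.
  apply/eqP => w0; move: wn; rewrite w0 -(scale0r (0 : 'cV_3)) hformZl mul0r.
  by case=> /eqP; rewrite eq_sym ?oner_eq0 ?pnatr_eq0.
have [e [f [eO fO ef]]] := Omx_hcross_factor wO.
have [a aE] := Omx_norm_int eO.
have [m am] : exists m : nat, `|a| = m by exists `|a|%N; rewrite abszE.
elim/ltn_ind: m e f a am eO fO ef aE => m IH e f a am eO fO ef aE.
have [a0|a0] := eqVneq a 0.
  exists e; split => //; last by rewrite aE a0.
    by apply: contraNneq w0 => e0; rewrite -ef e0 hcross0.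
  by rewrite -hform_conj -ef; have [-> _ _] := hcross_perp e f; rewrite conjC0.
(* Replacing [f] by [f - q *: e] brings the squared modulus of its product with [e] down to at most
   3a^2/4. *)
have [q qO [k [kE k0 ka]]] := Oth_round (Omx_hform fO eO) a0.
have [f' [f'O f'e ef']] : exists f',
    [/\ Omx f', hform f' e = hform f e - q * a%:~R & hcross e f' = w].
  exists (f - q *: e); split; last by rewrite hcross_shift.
    by apply: OmxB => //; apply: OmxZ.
  by rewrite -scaleN1r hformDl !hformZl mulN1r aE.
have [c cE] := Omx_norm_int f'O.
(* Lagrange's identity: minus the Gram determinant of the basis is the norm of [w]. *)
have kn : k - a * c = n.
  apply: (@intr_inj C); rewrite rmorphB rmorphM /= -nE -ef'.
  have [_ _ ->] := hcross_perp e f'.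
  by rewrite -aE -cE -kE -f'e hform_conj; ring.
have [ca|ac] := ltrP `|c| `|a|.
  (* The second vector is shorter: exchange the two and descend on the absolute norm of the
     first. *)
  have [m' cm] : exists m : nat, `|c| = m by exists `|c|%N; rewrite abszE.
  apply: (IH m' _ f' (- e) c) => //.
  - by move: ca; rewrite cm am.
  - by rewrite -scaleN1r; apply: OmxZ => //; solve_Oth.
  - by rewrite hcross_swap.
have [kz a1 cE'] := gauss_stop a0 k0 ka kn n12 ac.
have f'e0 : hform f' e = 0.
  by apply/eqP; rewrite -normr_eq0 -sqrf_eq0 normCK f'e kE kz.
have ef'0 : hform e f' = 0 by rewrite -hform_conj f'e0 conjC0.
have ac0 : a%:~R != 0 :> C by rewrite intr_eq0.
(* The reduced form is a (|x|^2 - n |y|^2), so [t *: e + f'] is isotropic as soon as |t|^2 = n; this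
   is solved by 1 when n = 1 and by theta when n = 2. *)
have comb t : t \in Oth -> t * t^* = n%:~R -> t != 0 ->
    exists v, [/\ Omx v, v != 0, hform v w = 0 & hform v v = 0].
  move=> tO tn t0; exists (t *: e + f'); split.
  - by apply: OmxD => //; apply: OmxZ.
  - apply/eqP => h; have : hform (t *: e + f') e = 0.
      by rewrite h -(scale0r (0 : 'cV_3)) hformZl mul0r.
    by move/eqP; rewrite hformDl hformZl f'e0 addr0 aE mulf_eq0 (negPf t0) (negPf ac0).
  - have [h1 h2 _] := hcross_perp e f'; rewrite ef' in h1 h2.
    by rewrite hformDl hformZl -(hform_conj w) h1 -(hform_conj w) h2 conjC0 mulr0 addr0.
  rewrite hformDl !hformDr !hformZl !hformZr f'e0 ef'0 aE cE cE' mulrA tn.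
  by rewrite rmorphN rmorphM /=; ring.
case: n12 => n12; rewrite n12 in comb.
  by apply: (comb 1); rewrite ?rpred1 ?conjC1 ?mulr1 ?oner_eq0.
apply: (comb theta); rewrite ?Oth_theta ?theta_neq0 //.
by rewrite conj_theta mulrN theta2 opprK.
Qed.

(** An integral vector pairing to 1 with [v] becomes isotropic after subtracting half its norm times
    [v], provided that norm is even. The cross product supplies the middle column. *)
Lemma isotropic_completion v : primitive_vec v -> hform v v = 0 ->
  exists A, [/\ A \in @unitaryJ C, Omx A & A *m cvec3 1 0 0 = v].
Proof.
move=> [vO [p pO vp]] vv.
have pv : hform p v = 1 by rewrite -hform_conj vp conjC1.
have [u [uO vu [h uu]]] : exists u, [/\ Omx u, hform v u = 1 &
    exists h : int, hform u u = (h + h)%:~R].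
  have [m mE] := Omx_norm_int pO.
  have [e1 e2 e3] := hcross_perp v p.
  rewrite vp pv vv mul0r subr0 mulr1 in e3.
  have [h mh] : exists h, m = h + h \/ m = h + h - 1 by exists ((m + 1) %/ 2)%Z; lia.
  case: mh => mh; first by exists p; split => //; exists h; rewrite mE mh.
  (* When the norm of [p] is odd, adding the cross product, of norm 1 and orthogonal to [v] and [p],
     makes it even. *)
  exists (p + hcross v p); split.
  - by apply: OmxD => //; apply: Omx_hcross.
  - by rewrite hformDr vp -(hform_conj _ v) e1 conjC0 addr0.
  exists h; rewrite hformDl !hformDr e3 e2 mE mh -(hform_conj _ p) e2 conjC0.
  by rewrite !(rmorphB, rmorphD) /=; ring.
pose x := u - h%:~R *: v.
have uv : hform u v = 1 by rewrite -hform_conj vu conjC1.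
have hr : (h%:~R : C)^* = h%:~R by rewrite rmorph_int.
have vx : hform v x = 1.
  by rewrite /x -scaleN1r hformDr !hformZr vv !mulr0 addr0.
have xx : hform x x = 0.
  rewrite {2}/x -scaleN1r hformDr !hformZr /x -scaleN1r !hformDl !hformZl.
  by rewrite uu uv vv vu hr conjCN conjC1 rmorphD /=; ring.
have xO : Omx x by apply: OmxB => //; apply: OmxZ => //; solve_Oth.
have [e1 e2 e3] := hcross_perp v x.
have xv : hform x v = 1 by rewrite -hform_conj vx conjC1.
exists (mat3 v (hcross v x) x); split.
- apply: unitary_mat3 => //; first by rewrite -hform_conj e1 conjC0.
  by rewrite e3 vx xv vv mul0r subr0 mulr1.
- by apply: Omx_mat3 => //; apply: Omx_hcross.
- by rewrite mat3_cvec3 scale1r !scale0r !addr0.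
Qed.

Definition orb w w' := exists A, [/\ A \in @unitaryJ C, Omx A & w' = A *m w].

Lemma orb_sym w w' : orb w w' -> orb w' w.
Proof.
move=> [A [uA oA ->]]; exists (invmx A); split.
- exact: unitaryJV.
- exact: Omx_inv.
- by rewrite mulKmx //; move: uA; rewrite inE => /andP[].
Qed.

Lemma orb_trans w1 w2 w3 : orb w1 w2 -> orb w2 w3 -> orb w1 w3.
Proof.
move=> [A [uA oA ->]] [B [uB oB ->]]; exists (B *m A); split.
- exact: unitaryJM.
- exact: Omx_mul.
- by rewrite mulmxA.
Qed.

Lemma orb_flip (x y : C) : orb (cvec3 x y 0) (cvec3 x (- y) 0).
Proof.
exists (mat3 (cvec3 1 0 0) (cvec3 0 (-1) 0) (cvec3 0 0 1)); split.
- by apply: unitary_mat3; rewrite hformE ?conjCN ?conjC0 ?conjC1; ring.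
- by apply: Omx_mat3; apply: Omx_cvec3; solve_Oth.
- by rewrite mat3_cvec3 !cvec3E; congr cvec3; ring.
Qed.

(** A Heisenberg translation fixing (1,0,0). Its corner entry is minus half the squared modulus of
    the parameter; multiples of theta make this half integral, since |theta|^2 = 2. *)
Lemma orb_translate (s x y : C) : s \in Oth ->
  orb (cvec3 x y 0) (cvec3 (x + theta * s * y) y 0).
Proof.
move=> sO.
exists (mat3 (cvec3 1 0 0) (cvec3 (theta * s) 1 0)
  (cvec3 (- (s * s^*)) (- (theta * s)^*) 1)); split.
- have t2 := theta2 C.
  apply: unitary_mat3; rewrite hformE ?(conjCN, conjCM, conjCK, conjC0, conjC1, conj_theta);
    try ring.
  transitivity (- (2 * (s * s^*)) - (theta * theta) * (s * s^*)); first by ring.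
  by rewrite t2; ring.
- by apply: Omx_mat3; apply: Omx_cvec3; solve_Oth.
- by rewrite mat3_cvec3 !cvec3E; congr cvec3; ring.
Qed.

End Orbits.

(** * Reduction of the vectors (x,y,0) to the three normal forms *)

Section Classification.
Variable C : numClosedFieldType.
Local Notation Oth := (@Oth C).
Local Notation theta := (@theta C).
Implicit Types (u v w x y : 'cV[C]_3) (A B M : 'M[C]_3).

Lemma int_half (a : int) : exists h, a = h + h \/ a = h + h + 1.
Proof. by exists (a %/ 2)%Z; lia. Qed.

(** Lets [ring] prove identities modulo the minimal polynomial of theta, given the cofactor [k]. *)
Lemma theta_reduce (k z z' : C) : z = z' + k * (theta * theta + 2) -> z = z'.
Proof. by rewrite theta2 addNr mulr0 addr0. Qed.

Lemma orb_refl w : orb w w.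
Proof.
exists 1%:M; split; [exact: unitaryJ1 | | by rewrite mul1mx].
by move=> i j; rewrite mxE rpred_nat.
Qed.

(** Once y = 1, translations change x by any multiple of theta, and x = a + b theta is congruent to
    0 or 1 according to the parity of a. *)
Lemma orb_norm1 w : primitive_vec w -> hform w w = 1 ->
  forall x y : C, w = cvec3 x y 0 ->
  orb w (cvec3 0 1 0) \/ orb w (cvec3 1 (-1) 0).
Proof.
move=> [wO _] ww x y wE.
have [? [? [? [+ xO yO _]]]] := Omx_cvec3P wO; rewrite wE.
move=> /cvec3_inj[xE yE _]; rewrite -{}xE in xO; rewrite -{}yE in yO.
have ow : orb (cvec3 x y 0) (cvec3 x 1 0).
  rewrite wE hformE conjC0 mulr0 add0r mul0r addr0 in ww.
  have [->|->] := Oth_unit_norm yO ww; last by rewrite -{2}[1]opprK; apply: orb_flip.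
  exact: orb_refl.
move: xO => /OthP[a [b xE]]; have [h ah] := int_half a.
have := @orb_translate C (- @Zth C b (- h)) x 1.
have -> : theta * - @Zth C b (- h) = - @Zth C (h + h) b.
  rewrite /Zth rmorphN rmorphD /=.
  transitivity (- (b%:~R * theta - h%:~R * (theta * theta))); first by ring.
  by rewrite theta2; ring.
have zO : - @Zth C b (- h) \in Oth by rewrite rpredN; apply/OthP; eexists; eexists.
move=> /(_ zO) ot; have {ot} ow := orb_trans ow ot.
case: ah => ah.
  left; move: ow; rewrite xE ah mulr1 subrr.
  by [].
right; apply: orb_trans ow _.
have -> : x + - @Zth C (h + h) b * 1 = 1.
  by rewrite xE ah /Zth !rmorphD /=; ring.
exact: orb_flip.
Qed.

(** Once y = theta, translations change x by any element of 2 Z[theta], so only the parities of a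
    and b in x = a + b theta remain; primitivity forces a to be odd. *)
Lemma orb_norm2 w : primitive_vec w -> hform w w = 2 ->
  forall x y : C, w = cvec3 x y 0 -> orb w (cvec3 1 0 1).
Proof.
move=> [wO [p pO wp]] ww x y wE.
have [? [? [? [+ xO yO _]]]] := Omx_cvec3P wO; rewrite wE.
move=> /cvec3_inj[xE yE _]; rewrite -{}xE in xO; rewrite -{}yE in yO.
have [ow yt] : orb (cvec3 x y 0) (cvec3 x theta 0) /\ (y = theta \/ y = - theta).
  rewrite wE hformE conjC0 mulr0 add0r mul0r addr0 in ww.
  have [->|->] := Oth_norm2 yO ww; last first.
    by split; [rewrite -{2}[theta]opprK; apply: orb_flip | right].
  split; last by left.
  exact: orb_refl.
move: xO => /OthP[a [b xE]]; have [h ah] := int_half a; have [k bk] := int_half b.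
have sO : @Zth C h k \in Oth by apply/OthP; eexists; eexists.
have := @orb_translate C _ x theta sO.
have -> : x + theta * @Zth C h k * theta = @Zth C (a - (h + h)) (b - (k + k)).
  rewrite xE mulrAC theta2 /Zth !(rmorphB, rmorphD) /=; ring.
move=> /(orb_trans ow) {}ow; apply: orb_trans ow _.
have a1 : a = h + h + 1.
  case: ah => // ah; exfalso.
  (* For a even, theta divides both x and y, so pairing with [p] would make theta a unit. *)
  have [z zO tz] : exists2 z, z \in Oth & theta * z = 1.
    move: wp; have [p1 [p2 [p3 [-> p1O p2O p3O]]]] := Omx_cvec3P pO.
    rewrite wE hformE mul0r addr0.
    have xt : x = theta * @Zth C b (- h).
      rewrite xE ah /Zth rmorphN rmorphD /=.
      transitivity (b%:~R * theta - h%:~R * (theta * theta)); last by ring.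
      by rewrite theta2; ring.
    have zO : @Zth C b (- h) \in Oth by apply/OthP; eexists; eexists.
    rewrite xt; case: yt => -> <-.
      by exists (@Zth C b (- h) * p3^* + p2^*); [solve_Oth | ring].
    by exists (@Zth C b (- h) * p3^* - p2^*); [solve_Oth | ring].
  case/OthP: zO => [c [d zE]]; move: tz; rewrite zE.
  have -> : theta * @Zth C c d = @Zth C (- (2 * d)) c.
    rewrite /Zth rmorphN rmorphM /=.
    transitivity (c%:~R * theta + d%:~R * (theta * theta)); first by ring.
    by rewrite theta2; ring.
  have -> : 1 = @Zth C 1 0 by rewrite /Zth mul0r addr0.
  by move=> /Zth_inj[]; clear; lia.
have -> : a - (h + h) = 1 by rewrite a1; ring.
case: bk => ->.
  rewrite subrr.
  (* The first column is isotropic and orthogonal to (1,0,1), and (1,0,1) minus it is theta times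
     the second column. *)
  exists (mat3 (cvec3 1 theta (-1)) (cvec3 0 (-1) (- theta)) (cvec3 0 0 1)); split.
  - apply: unitary_mat3; rewrite hformE ?(conjCN, conjCM, conjCK, conjC0, conjC1, conj_theta);
      try ring.
    by apply: (@theta_reduce (-1) _ _); ring.
  - by apply: Omx_mat3; apply: Omx_cvec3; solve_Oth.
  - rewrite mat3_cvec3 !cvec3E /Zth mul0r addr0; congr cvec3; try ring.
    by apply: (@theta_reduce 1 _ _); ring.
have -> : k + k + 1 - (k + k) = 1 by ring.
have -> : @Zth C 1 1 = 1 + theta by rewrite /Zth mul1r.
have conj2 : (2 : C)^* = 2 by rewrite conjC_nat.
(* The first column [c] is isotropic, orthogonal to [w := cvec3 1 0 1] and such that
   [w - (1 + theta) c] is divisible by [theta], the quotient being the second column. *)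
exists (mat3 (cvec3 (-1 + theta) (-2 + theta) (1 - theta))
         (cvec3 (- (2 * theta)) (1 - 2 * theta) theta)
         (cvec3 (- (2 * theta)) (- (2 * theta)) (1 + theta))); split.
- apply: unitary_mat3; rewrite hformE
    ?(conjCN, conjCD, conjCM, conjCK, conjC0, conjC1, conj2, conj_theta).
  + by apply: (@theta_reduce (1) _ _); ring.
  + by apply: (@theta_reduce (-1) _ _); ring.
  + by apply: (@theta_reduce (-1) _ _); ring.
  + by apply: (@theta_reduce (0) _ _); ring.
  + by apply: (@theta_reduce (0) _ _); ring.
  + by apply: (@theta_reduce (0) _ _); ring.
- by apply: Omx_mat3; apply: Omx_cvec3; solve_Oth.
- rewrite mat3_cvec3 !cvec3E; congr cvec3.
  + by apply: (@theta_reduce (1) _ _); ring.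
  + by apply: (@theta_reduce (1) _ _); ring.
  + by apply: (@theta_reduce (0) _ _); ring.
Qed.

End Classification.

(** * Groups of order two, and the separation of the three orbits *)

Lemma set2_cyclic_of_order2 (G : groupType) (g : G) : g <> 1%g -> (g * g)%g = 1%g ->
  cyclic_of_order 2 [set h : G | h = 1%g \/ h = g]%classic.
Proof.
move=> g1 gg; have gV : (g^-1)%g = g by apply: (mulIg g); rewrite mulVg gg.
have gX k : (g ^+ k)%g = if odd k then g else 1%g.
  by elim: k => [|k IH]; rewrite ?expg0 // expgS IH /=; case: (odd k); rewrite ?gg ?mulg1.
have gXV k : (g ^- k)%g = if odd k then g else 1%g.
  by rewrite gX; case: (odd k); rewrite ?gV ?invg1.
split.
  exists g; apply/seteqP; split=> h /=.
    by case=> ->; [exists 0%N | exists 1%N]; left; rewrite gX.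
  by move=> [k []->]; rewrite ?(gXV, gX); case: (odd k); by [left | right].
apply/card_set_bijP.
exists (fun h => if h == 1%g then 0%N else 1%N); split => /=.
- by move=> h _; case: ifP.
- move=> x y; rewrite !inE => -[]-> []->; rewrite ?eqxx //.
  + by case: eqP.
  + by case: eqP.
- move=> [|[|//]] _ /=; first by exists 1%g; [left | rewrite eqxx].
  by exists g; [right | case: eqP].
Qed.

Section WvecOrbits.
Variable C : numClosedFieldType.
Local Notation Oth := (@Oth C).
Local Notation theta := (@theta C).
Implicit Types (u v w x y : 'cV[C]_3) (A B M : 'M[C]_3) (i j : 'I_3).

Lemma mulmx_ext A B : (forall y, A *m y = B *m y) -> A = B.
Proof.
move=> h; apply/matrixP => i j.
have : col j A = col j B by rewrite !colE h.
by move=> /colP/(_ i); rewrite !mxE.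
Qed.

Lemma wvecE i : [\/ i = ord0 /\ wvec C i = cvec3 0 1 0,
  i = inord 1 /\ wvec C i = cvec3 1 (-1) 0 | i = inord 2 /\ wvec C i = cvec3 1 0 1].
Proof.
case: i => [[|[|[|//]]] h]; [constructor 1 | constructor 2 | constructor 3]; split => //;
  by apply: val_inj; rewrite /= ?inordK.
Qed.

Lemma wvec_norm i : hform (wvec C i) (wvec C i) = 1 \/ hform (wvec C i) (wvec C i) = 2.
Proof.
by case: (wvecE i) => -[_ ->]; [left | left | right];
  rewrite hformE ?conjCN ?conjC0 ?conjC1; ring.
Qed.

Lemma wvec_pos i : 0 < hform (wvec C i) (wvec C i).
Proof. by case: (wvec_norm i) => ->; rewrite ?ltr01 ?ltr0n. Qed.

Lemma wvec_primitive i : primitive_vec (wvec C i).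
Proof.
have o3 : Omx (cvec3 0 0 1 : 'cV[C]_3) by apply: Omx_cvec3; solve_Oth.
have o2 : Omx (cvec3 0 1 0 : 'cV[C]_3) by apply: Omx_cvec3; solve_Oth.
by case: (wvecE i) => -[_ ->]; (split; first by apply: Omx_cvec3; solve_Oth);
  [exists (cvec3 0 1 0) | exists (cvec3 0 0 1) | exists (cvec3 0 0 1)] => //;
  rewrite hformE ?conjCN ?conjC0 ?conjC1; ring.
Qed.

Lemma orb_wvec w : primitive_vec w -> hform w w = 1 \/ hform w w = 2 ->
  exists i, orb w (wvec C i).
Proof.
move=> pw ww; have [wO _] := pw.
have [v [vO v0 vw vv]] := isotropic_in_polar wO ww.
have [g [v' [gO g0 pv' vE]]] := primitive_part vO v0.
have v'w : hform v' w = 0.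
  by apply: (mulfI g0); rewrite -hformZl -vE vw mulr0.
have v'v' : hform v' v' = 0.
  apply/eqP; move/eqP: vv; rewrite vE hformZl hformZr !mulf_eq0 conjC_eq0.
  by rewrite (negPf g0).
have [A [uA oA Ae]] := isotropic_completion pv' v'v'.
have [x [y [z w'E]]] := cvec3P (invmx A *m w).
have unA : A \in unitmx by move: uA; rewrite inE => /andP[].
have wE : w = A *m cvec3 x y z by rewrite -w'E mulKVmx.
(* After the isotropic vector has been moved to (1,0,0), orthogonality to it reads off the last
   coordinate. *)
have z0 : z = 0.
  move: v'w; rewrite -Ae wE hform_unitary // hformE !mul0r !addr0 mul1r => h.
  by apply/eqP; rewrite -conjC_eq0 h.
rewrite z0 in w'E wE.
have ow : orb w (cvec3 x y 0).
  by exists (invmx A); split; [exact: unitaryJV | exact: Omx_inv | rewrite w'E].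
have pw' : primitive_vec (cvec3 x y 0 : 'cV[C]_3).
  by rewrite -w'E; apply: primitive_mul pw; [exact: unitaryJV | exact: Omx_inv].
have nw' : hform (cvec3 x y 0) (cvec3 x y 0) = hform w w by rewrite wE hform_unitary.
case: ww => ww; rewrite ww in nw'.
  case: (orb_norm1 pw' nw' erefl) => h; [exists ord0 | exists (inord 1)].
    by apply: orb_trans ow _.
  apply: orb_trans ow _; case: (wvecE (inord 1)) => -[/(congr1 val)]; rewrite /= ?inordK //.
  by move=> _ ->.
exists (inord 2); apply: orb_trans ow _.
case: (wvecE (inord 2)) => -[/(congr1 val)]; rewrite /= ?inordK //.
by move=> _ ->; apply: orb_norm2 pw' nw' _ _ erefl.
Qed.

(* Modulo [theta] the vector [wvec 0] is characteristic. *)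
Lemma hform_char z : Omx z ->
  exists2 t, t \in Oth & hform z z - hform z (cvec3 0 1 0) = theta * t.
Proof.
move=> /Omx_cvec3P[a [b [c [-> aO bO cO]]]].
move: (bO) => /OthP[p [q bE]].
have [k kE] : exists k : int, p * p - p = k + k.
  by have [h [->|->]] := int_half p; [exists (2 * (h * h) - h) | exists (2 * (h * h) + h)]; ring.
have /OthP[r [s acE]] : a * c^* \in Oth by solve_Oth.
(* The difference equals 2 (r + k + q^2) - q theta, and 2 = - theta^2. *)
exists (- (theta * (r + k + q * q)%:~R) - q%:~R).
  by solve_Oth; apply: Oth_int.
rewrite !hformE conjC0 conjC1 !mulr0 add0r addr0 mulr1.
rewrite -[c * a^*]conjCK conjCM conjCK [c^* * a]mulrC acE conj_Zth.
have bb := Zth_norm C p q; rewrite -bE in bb; rewrite bb bE /Zth.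
have -> : p * p + 2 * (q * q) = p + (k + k) + 2 * (q * q) by rewrite -kE; ring.
rewrite !(rmorphD, rmorphN, rmorphM) /=.
by apply: (@theta_reduce C (r%:~R + k%:~R + q%:~R * q%:~R)); ring.
Qed.

Lemma theta_nonunit (z : C) : z \in Oth -> theta * z <> 1.
Proof.
move=> zO e; have [n nE] := Oth_normN zO.
have : theta * z * (theta * z)^* = 1 by rewrite e conjC1 mulr1.
rewrite conjCM mulrACA nE conj_theta mulrN theta2 opprK -natrM => /eqP.
by rewrite -[1]/(1%:R) eqr_nat => /eqP; clear; lia.
Qed.

(** The scalar c is integral, so norms exclude passing from norm 1 to norm 2. Only upward moves are
    excluded here; [orb_wvec_inj] applies this to the inverse for the others. *)
Lemma orb_wvec_le A i j (c : C) : A \in @unitaryJ C -> Omx A ->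
  A *m wvec C i = c *: wvec C j -> (j <= i)%N.
Proof.
move=> uA oA h; rewrite leqNgt; apply/negP => ij.
have cO : c \in Oth.
  apply: (primitive_scale (wvec_primitive j)); rewrite -h.
  by apply: Omx_mul => //; case: (wvec_primitive i).
have [n nE] := Oth_normN cO.
have hn : hform (wvec C i) (wvec C i) = n%:R * hform (wvec C j) (wvec C j).
  by rewrite -(hform_unitary _ _ uA) h hformZl hformZr mulrA nE.
case: (wvecE j) => -[jE wj]; first by rewrite jE in ij.
  have {ij} iE : i = ord0 by apply: val_inj; move: ij; rewrite jE /= inordK //; case: (val i).
  have wi : wvec C i = cvec3 0 1 0 by rewrite iE.
  have y0 : Omx (cvec3 0 0 1 : 'cV[C]_3) by apply: Omx_cvec3; solve_Oth.
  have unA : A \in unitmx by move: uA; rewrite inE => /andP[].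
  (* The preimage of (0,0,1) is isotropic and its product with [wvec C i] is the conjugate of c, so
     theta divides that conjugate; but c has norm 1, and theta would be a unit. *)
  have [t tO] := hform_char (Omx_mul (Omx_inv uA oA) y0).
  have zz := hform_unitary (invmx A *m cvec3 0 0 1) (invmx A *m cvec3 0 0 1) uA.
  have zw := hform_unitary (invmx A *m cvec3 0 0 1) (wvec C i) uA.
  rewrite mulKVmx // in zz; rewrite mulKVmx // h wj hformZr in zw.
  rewrite -wi -zz -zw !hformE.
  rewrite !(mul0r, mulr0, add0r, addr0, conjC0, conjC1, mul1r, mulr1) => e.
  apply: (@theta_nonunit (- (t * c))); first by solve_Oth.
  rewrite mulrN mulrA -e mulNr opprK mulrC nE.
  move: hn; rewrite wi wj !hformE !(mul0r, mulr0, add0r, addr0, conjC0, conjC1, mul1r, mulr1).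
  by rewrite conjCN conjC1 mulrNN !mulr1 => <-.
have wi : hform (wvec C i) (wvec C i) = 1.
  case: (wvecE i) => -[iE ->]; rewrite ?hformE ?(conjCN, conjC0, conjC1); try ring.
  by rewrite iE jE ltnn in ij.
have wj2 : hform (wvec C j) (wvec C j) = 2.
  by rewrite wj hformE conjC0 conjC1; ring.
move: hn; rewrite wi wj2 -natrM => /eqP.
by rewrite -[1]/(1%:R) eqr_nat => /eqP; clear; lia.
Qed.

Lemma orb_wvec_inj A i j (c : C) : A \in @unitaryJ C -> Omx A ->
  A *m wvec C i = c *: wvec C j -> i = j.
Proof.
move=> uA oA h; apply: val_inj; apply/eqP; rewrite eqn_leq (orb_wvec_le uA oA h) andbT.
have unA : A \in unitmx by move: uA; rewrite inE => /andP[].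
apply: (@orb_wvec_le (invmx A) j i c^-1); [exact: unitaryJV | exact: Omx_inv |].
have c0 : c != 0.
  apply: contraTneq (wvec_pos i) => c0.
  by rewrite -(hform_unitary _ _ uA) h c0 hformZl mul0r ltxx.
by rewrite -[wvec C i](mulKmx unA) h -scalemxAr scalerA mulVf // scale1r.
Qed.

Definition refl w : 'M[C]_3 := 1%:M - (2 / hform w w) *: (w *m (w ^t* *m @J C)).

Lemma refl_mul w y : refl w *m y = y - (2 / hform w w * hform y w) *: w.
Proof.
rewrite mulmxBl mul1mx -scalemxAl -scalerA; congr (_ - _ *: _).
rewrite -mulmxA; apply/colP => k; rewrite !mxE big_ord_recl big_ord0 addr0.
by rewrite [_ * w k 0]mulrC.
Qed.

End WvecOrbits.

(** * Reflections in the group, pointwise stabilizers and orbits of mirrors *)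

Section Reflections.
Variable C : numClosedFieldType.
Local Notation Oth := (@Oth C).
Implicit Types (u v w x y : 'cV[C]_3) (A B M : 'M[C]_3) (i j : 'I_3).

Lemma mat3_1 : mat3 (cvec3 1 0 0) (cvec3 0 1 0) (cvec3 0 0 1) = 1%:M :> 'M[C]_3.
Proof.
apply/matrixP => i j; rewrite !mxE.
by case: i => [[|[|[|//]]] ?]; case: j => [[|[|[|//]]] ?]; rewrite /= mxE.
Qed.

Lemma unitaryJ_of_hform A : (forall x y, hform (A *m x) (A *m y) = hform x y) ->
  A \in @unitaryJ C.
Proof.
move=> h; rewrite -[A]mulmx1 -mat3_1 mul_mat3.
by apply: unitary_mat3; rewrite h hformE ?conjC0 ?conjC1; ring.
Qed.

Lemma Omx_of_cols A : (forall y, Omx y -> Omx (A *m y)) -> Omx A.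
Proof.
move=> h; rewrite -[A]mulmx1 -mat3_1 mul_mat3.
by apply: Omx_mat3; apply: h; apply: Omx_cvec3; solve_Oth.
Qed.

Lemma refl_unitary w : hform w w != 0 -> refl w \in @unitaryJ C.
Proof.
move=> w0; apply: unitaryJ_of_hform => x y; rewrite !refl_mul.
rewrite -!scaleN1r !(hformDl, hformDr, hformZl, hformZr).
have nr : (hform w w)^* = hform w w by apply: hform_conj.
rewrite !(conjCM, conjCN, conjC1, fmorphV) /= nr hform_conj conjC_nat.
by field.
Qed.

Lemma refl_integral w : Omx w -> hform w w = 1 \/ hform w w = 2 -> Omx (refl w).
Proof.
move=> wO wn; apply: Omx_of_cols => y yO; rewrite refl_mul.
apply: OmxB => //; apply: OmxZ => //; have := Omx_hform yO wO.
case: wn => ->; first by rewrite divr1 => ?; solve_Oth.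
by rewrite divff ?mul1r // pnatr_eq0.
Qed.

Lemma refl_sqr w : hform w w != 0 -> refl w *m refl w = 1%:M.
Proof.
move=> w0; apply: mulmx_ext => y; rewrite -mulmxA !refl_mul mul1mx.
rewrite -scaleN1r hformDl !hformZl -addrA -[in X in _ + X]scaleN1r !scalerA -scalerDl.
by rewrite -[RHS]addr0 -[in RHS](scale0r w); congr (_ + _ *: _); field.
Qed.

Lemma fixes_mirror1 w : fixes_pointwise (1%g : PU C) (mirror w).
Proof.
by move=> p /mirrorP[v [-> _ _]]; rewrite -[1%g]/(\pi_(PU C) 1%g) act_line mul1mx.
Qed.

Lemma Gamma1 : Gamma 2 (1%g : PU C).
Proof.
exists (1%g : UJ C) => //; apply/Omx_GL3; first exact: unitaryJ1.
by move=> i j; rewrite mxE rpred_nat.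
Qed.

(** Integral unitary lifts of the stabilizer are scalars or scalar multiples of [refl w];
    projectively this leaves the identity and one involution. *)
Lemma stabilizer_cyclic w : Omx w -> hform w w = 1 \/ hform w w = 2 ->
  cyclic_of_order 2 (pointwise_stabilizer (@Gamma C 2) (mirror w)).
Proof.
move=> wO wn.
have w0 : 0 < hform w w by case: wn => ->; rewrite ?ltr01 ?ltr0n.
have nw : hform w w != 0 by rewrite gt_eqF.
pose R : UJ C := MkUJ (refl_unitary nw).
have [v [_ [[_ vw _] v0 _ _ _]]] := mirror_frame w0.
(* A scalar matrix is impossible: the reflection fixes [v] and sends [w] to its opposite. *)
have R1 : \pi_(PU C) R <> 1%g.
  move=> /eqP/PU_eqP[c /= RE].
  have Ry y : refl w *m y = c *: y by rewrite RE -scalemxAl mul1mx.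
  have c1 : c = 1.
    have := Ry v; rewrite refl_mul vw mulr0 scale0r subr0 => /(congr1 (fun x => @hform C x v)).
    by rewrite hformZl -[LHS]mul1r => /mulIf ->; rewrite // lt_eqF.
  have := Ry w; rewrite c1 scale1r refl_mul divfK // => /(congr1 (fun x => @hform C x w)).
  rewrite -scaleN1r hformDl !hformZl => /eqP; rewrite addrC -subr_eq0 addrK.
  by rewrite !mulf_eq0 oppr_eq0 oner_eq0 pnatr_eq0 (negPf nw).
have RR : (\pi_(PU C) R * \pi_(PU C) R)%g = 1%g.
  rewrite -[LHS]/(PU_mul _ _) PU_mulE; congr (\pi_(PU C) _).
  by apply: val_inj; rewrite /= refl_sqr.
have -> : pointwise_stabilizer (@Gamma C 2) (mirror w)
    = [set h | h = 1%g \/ h = \pi_(PU C) R]%classic.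
  apply/seteqP; split => g /=.
    move=> [[A /Omx_GL3 oA <-] fA].
    have [e _ [AE|Ay]] := fixes_mirror_integral (oA (UJmxP A)) w0 fA.
      by left; apply/eqP/PU_eqP; exists e.
    right; apply/eqP/PU_eqP; exists e; apply: mulmx_ext => y.
    by rewrite Ay -scalemxAl refl_mul.
  case=> ->; first by split; [exact: Gamma1 | exact: fixes_mirror1].
  split.
    exists R => //; apply/Omx_GL3; first exact: UJmxP.
    exact: refl_integral.
  move=> p /mirrorP[x [-> _ xw]]; rewrite act_line /= refl_mul xw.
  by rewrite mulr0 scale0r subr0.
exact: set2_cyclic_of_order2.
Qed.

Lemma reflection_mirror_orbit (g : PU C) w : Gamma 2 g -> complex_reflection_with_mirror g w ->
  exists i, exists2 h : PU C, Gamma 2 h & mirror w = [set act h p | p in mirror (wvec C i)]%classic.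
Proof.
move=> [A /Omx_GL3 oA <-] [g1 _ w0 fA].
have {}oA := oA (UJmxP A).
have [e e1 [AE|Ay]] := fixes_mirror_integral oA w0 fA.
  by case: g1; apply/eqP/PU_eqP; exists e.
have [k [w' [k0 wE pw' w'n]]] := reflection_primitive oA w0 e1 Ay.
have [i /orb_sym[B [uB oB w'E]]] := orb_wvec pw' w'n.
exists i, (\pi_(PU C) (MkUJ uB)).
  by exists (MkUJ uB) => //; apply/Omx_GL3.
by rewrite act_mirror /= -w'E wE mirror_scale.
Qed.

(** A mirror determines its polar vector only up to a scalar, hence the factor [c] allowed in
    [orb_wvec_inj]. *)
Lemma mirror_orbit_inj (w : 'cV[C]_3) i j (h k : PU C) : Gamma 2 h -> Gamma 2 k ->
  mirror w = [set act h p | p in mirror (wvec C i)]%classic ->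
  mirror w = [set act k p | p in mirror (wvec C j)]%classic -> i = j.
Proof.
move=> [A /Omx_GL3 oA <-] [B /Omx_GL3 oB <-].
have {}oA := oA (UJmxP A); have {}oB := oB (UJmxP B).
rewrite !act_mirror => -> /mirror_inj[|c E].
  by rewrite hform_unitary ?wvec_pos ?UJmxP.
apply/esym/(@orb_wvec_inj C (invmx A *m B) j i c).
- by apply: unitaryJM; [apply: unitaryJV|]; exact: UJmxP.
- by apply: Omx_mul => //; apply: Omx_inv => //; exact: UJmxP.
- by rewrite -mulmxA E -scalemxAr mulKmx // UJ_unit.
Qed.

End Reflections.

Theorem mainTheorem7 (R : realType) :
  (forall (g : PU R[i]) (w : 'cV[R[i]]_3),
     @Gamma R[i] 2 g -> complex_reflection_with_mirror g w ->
     exists! i : 'I_3, exists2 h : PU R[i], @Gamma R[i] 2 h &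
       mirror w = [set act h p | p in mirror (@wvec R[i] i)])
  /\
  (forall i : 'I_3,
     cyclic_of_order 2
       (pointwise_stabilizer (@Gamma R[i] 2) (mirror (@wvec R[i] i)))).
Proof.
split=> [g w gG gw|i]; last first.
  by apply: stabilizer_cyclic; [case: (wvec_primitive R[i] i) | exact: wvec_norm].
have [i [h hG hw]] := reflection_mirror_orbit gG gw.
exists i; split; first by exists h.
by move=> j [k kG kw]; apply: mirror_orbit_inj hG kG hw kw.
Qed.
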